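(* Let $a=(a_1,a_2,a_3,a_4)\in\mathbb{C}^4$ and $\tilde a:=(a_2,a_1,a_3,a_4)$, and let $$C:=\{b\in\mathbb{C}^4\mid \forall i\in\{1,2,3,4\},\ b_i=b_i^2,\ \text{ and } b_2b_4=b_1b_3=0\}.$$ The properad $\mathcal{P}_a$ induces a confluent system if and only if $a\in C$ and $\tilde a\in C$; that is, if and only if $a_i=a_i^2$ for all $i\in\{1,2,3,4\}$ and $a_1a_3=a_1a_4=a_2a_3=a_2a_4=0$.
   Context: All vector spaces are over $\mathbb{C}$. An $\mathbb{S}$-bimodule $P$ is a family $P(m,n)$, $m,n\in\mathbb{N}$, of vector spaces with commuting left $\mathbb{S}_m$- and right $\mathbb{S}_n$-actions; elements of $P(m,n)$ are thought of as operations with $m$ outputs and $n$ inputs. A properad is a monoid for the connected composition product of $\mathbb{S}$-bimodules (compositions along connected two-level directed graphs). $\mathcal{F}(E)$ is the free properad on $E$, spanned by connected directed acyclic graphs with vertices decorated by $E$; the weight is the number of vertices, and $\mathcal{F}^{(w)}(E)$ is the weight $w$ part. The family $\mathcal{P}_a$. Let $E$ be generated by a product $\mu\in E(1,2)$ and a coproduct $\Delta\in E(2,1)$ without symmetry: $E(1,2)\cong\mathbb{C}[\mathbb{S}_2]$, $E(2,1)\cong\mathbb{C}[\mathbb{S}_2]$, and $E$ is zero in other biarities. Let $\tau$ be the transposition of two strands. For $a=(a_1,a_2,a_3,a_4)\in\mathbb{C}^4$ put $$\between_a:=\Delta\circ\mu-a_1(\mathrm{id}\otimes\mu)(\Delta\otimes\mathrm{id})-a_2(\mu\otimes\mathrm{id})(\mathrm{id}\otimes\Delta)-a_3(\mu\otimes\mathrm{id})(\mathrm{id}\otimes\tau)(\Delta\otimes\mathrm{id})-a_4(\mathrm{id}\otimes\mu)(\tau\otimes\mathrm{id})(\mathrm{id}\otimes\Delta),$$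 i.e. in Sweedler notation $\between_a=0$ reads $\Delta(xy)=a_1\,x_1\otimes x_2y+a_2\,xy_1\otimes y_2+a_3\,x_1y\otimes x_2+a_4\,y_1\otimes xy_2$. Then $\mathcal{P}_a:=\mathcal{F}(E)/(R)$, where $R$ is spanned (as an $\mathbb{S}$-bimodule) by $\mu(\mu\otimes\mathrm{id})-\mu(\mathrm{id}\otimes\mu)$, $(\Delta\otimes\mathrm{id})\Delta-(\mathrm{id}\otimes\Delta)\Delta$ and $\between_a$. Confluence. A rewriting system is a set $X$ with a binary relation $\to$; write $b\twoheadrightarrow c$ if $c$ is reached from $b$ by a finite sequence of steps; it is confluent if whenever $b\twoheadleftarrow x\twoheadrightarrow c$ there is $d$ with $b\twoheadrightarrow d\twoheadleftarrow c$. Take on $\mathcal{F}^{(2)}(E)$ the rules $\mu(\mu\otimes\mathrm{id})\to\mu(\mathrm{id}\otimes\mu)$, $(\Delta\otimes\mathrm{id})\Delta\to(\mathrm{id}\otimes\Delta)\Delta$, $\Delta\circ\mu\to\Delta\circ\mu-\between_a$ (with all relabelings of inputs and outputs), and on $\mathcal{F}^{(3)}(E)$ the induced linear rewriting: a step replaces, in a linear combination of basis graphs, one basis graph occurring with nonzero coefficient by the result of applying a rule to a weight-$2$ subgraph of it. $\mathcal{P}_a$ induces a confluent system if this rewriting system on $\mathcal{F}^{(3)}(E)$ is confluent. *)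

(* Defs.v *)
From HB Require Import structures.
From Stdlib Require Import Relation_Operators.
From mathcomp Require Import all_boot all_algebra.
From mathcomp Require Import boolp reals.
From mathcomp Require Export complex.
From mathcomp Require Export freeg.

Set Implicit Arguments.
Unset Strict Implicit.
Unset Printing Implicit Defensive.

Import GRing.Theory.
Local Open Scope ring_scope.
Local Open Scope quotient_scope.

(* Throughout, [m] is the number of outputs and [n] the number of inputs.     *)
(* A directed graph with legs is encoded as the list of its vertices, each    *)
(* vertex recording the names of its incident wires. The external wires are   *)
(* named by the legs; the names of the internal ones are arbitrary.           *)

Inductive wire (m n : nat) := In of 'I_n | Out of 'I_m | Int of nat.
Arguments In {m n}.
Arguments Out {m n}.
Arguments Int {m n}.

Definition wire_code m n (x : wire m n) : 'I_n + 'I_m + nat :=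
  match x with
  | In i => inl (inl i) | Out j => inl (inr j) | Int k => inr k
  end.
Definition wire_decode m n (x : 'I_n + 'I_m + nat) : wire m n :=
  match x with
  | inl (inl i) => In i | inl (inr j) => Out j | inr k => Int k
  end.
Lemma wire_codeK m n : cancel (@wire_code m n) (@wire_decode m n).
Proof. by case. Qed.
HB.instance Definition _ m n := Countable.copy (wire m n) (can_type (@wire_codeK m n)).

(* [Mu x y z] multiplies the inputs [x], [y] (in this order) into [z];        *)
(* [Delta x y z] splits the input [x] into the outputs [y], [z] (in this      *)
(* order). Since E(1,2) and E(2,1) are regular representations, a decoration  *)
(* of a vertex by a basis element of E is exactly a choice of mu or Delta     *)
(* together with an ordering of the wires on its two-valent side.             *)
Inductive node (W : Type) := Mu of W & W & W | Delta of W & W & W.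

Definition node_code W (v : node W) : (W * W * W) + (W * W * W) :=
  match v with
  | Mu x y z => inl (x, y, z) | Delta x y z => inr (x, y, z)
  end.
Definition node_decode W (v : (W * W * W) + (W * W * W)) : node W :=
  match v with
  | inl (x, y, z) => Mu x y z | inr (x, y, z) => Delta x y z
  end.
Lemma node_codeK W : cancel (@node_code W) (@node_decode W).
Proof. by case. Qed.
HB.instance Definition _ (W : countType) :=
  Countable.copy (node W) (can_type (@node_codeK W)).

Definition map_node W W' (f : W -> W') (v : node W) : node W' :=
  match v with
  | Mu x y z => Mu (f x) (f y) (f z) | Delta x y z => Delta (f x) (f y) (f z)
  end.

Definition ins W (v : node W) : seq W :=
  match v with Mu x y _ => [:: x; y] | Delta x _ _ => [:: x] end.
Definition outs W (v : node W) : seq W :=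
  match v with Mu _ _ z => [:: z] | Delta _ y z => [:: y; z] end.

Definition diagram (m n : nat) := seq (node (wire m n)).

HB.instance Definition _ m n := Countable.on (diagram m n).

Definition rename m n (f : nat -> nat) (x : wire m n) : wire m n :=
  if x is Int k then Int (f k) else x.

Definition iso m n (d e : diagram m n) : bool :=
  `[< exists f : nat -> nat,
        bijective f /\ perm_eq (map (map_node (rename f)) d) e >].

Lemma map_nodeE W1 W2 W3 (f : W1 -> W2) (g : W2 -> W3) h (d : seq (node W1)) :
  (forall x, g (f x) = h x) ->
  map (map_node g) (map (map_node f) d) = map (map_node h) d.
Proof. by move=> gf; rewrite -map_comp; apply: eq_map => -[x y z|x y z] /=; rewrite !gf. Qed.

Lemma map_node_id W (g : W -> W) (d : seq (node W)) :
  (forall x, g x = x) -> map (map_node g) d = d.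
Proof. by move=> gI; rewrite -[RHS]map_id; apply: eq_map => -[x y z|x y z] /=; rewrite !gI. Qed.

Lemma iso_refl m n : reflexive (@iso m n).
Proof.
move=> d; apply/asboolP; exists id; split; first by exists id.
by rewrite map_node_id //; case.
Qed.

Lemma iso_sym m n : symmetric (@iso m n).
Proof.
have sub (d e : diagram m n) : iso d e -> iso e d.
  move=> /asboolP[f [[g fK gK] de]]; apply/asboolP; exists g; split; first by exists f.
  rewrite perm_sym in de; move: (perm_map (map_node (rename g)) de) => /perm_trans; apply.
  by rewrite (map_nodeE (h := id)) ?map_node_id // => -[i|j|k] //=; rewrite fK.
by move=> d e; apply/idP/idP; exact: sub.
Qed.

Lemma iso_trans m n : transitive (@iso m n).
Proof.
move=> e d c /asboolP[f [bf de]] /asboolP[g [bg ec]]; apply/asboolP.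
exists (g \o f); split; first exact: bij_comp.
apply: perm_trans ec; move: (perm_map (map_node (rename g)) de).
by rewrite (map_nodeE (h := rename (g \o f))) // => -[].
Qed.

Canonical iso_equiv m n :=
  EquivRel (@iso m n) (@iso_refl m n) (@iso_sym m n) (@iso_trans m n).

Definition graph (m n : nat) := {eq_quot (@iso_equiv m n)}.

HB.instance Definition _ m n := Choice.on (graph m n).
HB.instance Definition _ m n := EqQuotient.on (graph m n).

Definition graph_of m n (d : diagram m n) : graph m n := \pi_(graph m n) d.

(* Every leg is attached to exactly one vertex, and every internal wire joins *)
(* exactly one vertex output to exactly one vertex input. (A strand from an   *)
(* input leg to an output leg cannot be written, but a connected graph with   *)
(* at least one vertex has none.)                                             *)
Definition well_wired m n (d : diagram m n) : Prop :=
  exists s : seq nat, [/\ uniq s,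
    perm_eq (flatten (map (@ins _) d)) (map In (enum 'I_n) ++ map Int s) &
    perm_eq (flatten (map (@outs _) d)) (map Out (enum 'I_m) ++ map Int s)].

Definition feeds m n (d : diagram m n) : rel 'I_(size d) :=
  fun u v => has (mem (ins (tnth (in_tuple d) v))) (outs (tnth (in_tuple d) u)).

Definition acyclic m n (d : diagram m n) : Prop :=
  forall u v, feeds (d := d) u v -> ~~ connect (@feeds m n d) v u.

Definition connected m n (d : diagram m n) : Prop :=
  forall u v, connect (fun x y => feeds (d := d) x y || feeds y x) u v.

Definition properadic_graph (w : nat) m n (g : graph m n) : Prop :=
  let d := repr g in [/\ size d = w, well_wired d, acyclic d & connected d].

Definition lincomb (K : fieldType) (m n : nat) := {freeg (graph m n) / K}.

(* Component of weight [w] (for [w] > 0) and biarity (m, n) of the free       *)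
(* properad on E. A connected graph with legs fixed pointwise has no          *)
(* non-trivial automorphism here, so isomorphism classes form a basis.        *)
Definition free_properad (K : fieldType) (w m n : nat) (x : lincomb K m n) : Prop :=
  forall g : graph m n, coeff g x != 0 -> properadic_graph w g.

(* A graph with one distinguished vertex of biarity (p, q), the hole: the     *)
(* other vertices, and the wires attached to the legs of the hole.            *)
Record context (m n p q : nat) := Context {
  others : diagram m n;
  hole_in : 'I_q -> wire m n;
  hole_out : 'I_p -> wire m n }.

(* Internal wires of the context get even names, those of the graph put in    *)
(* the hole odd names.                                                        *)
Definition outer m n (x : wire m n) : wire m n := rename double x.
Definition inner m n p q (c : context m n p q) (x : wire p q) : wire m n :=
  match x with
  | In i => outer (hole_in c i)
  | Out j => outer (hole_out c j)
  | Int k => Int k.*2.+1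
  end.

Definition plug_diagram m n p q (c : context m n p q) (d : diagram p q) : diagram m n :=
  map (map_node (@outer m n)) (others c) ++ map (map_node (inner c)) d.

Definition plug m n p q (c : context m n p q) (g : graph p q) : graph m n :=
  graph_of (plug_diagram c (repr g)).

Lemma plug_graph_of m n p q (c : context m n p q) (d : diagram p q) :
  plug c (graph_of d) = graph_of (plug_diagram c d).
Proof.
apply/eqmodP => /=; rewrite /plug_diagram.
have /asboolP[f [[g fK gK] de]] : iso (repr (graph_of d)) d.
  by apply/(@eqmodP _ (iso_equiv p q)); rewrite reprK.
pose F (h : nat -> nat) k := if odd k then (h k./2).*2.+1 else k.
have FK h h' : cancel h h' -> cancel (F h) (F h').
  move=> hK k; rewrite /F; case: (boolP (odd k)) => [ok|/negbTE->//] /=.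
  rewrite odd_double /= uphalf_double hK.
  by rewrite -[RHS]odd_double_half ok.
apply/asboolP; exists (F f); split; first by exists (F g); exact: FK.
have oF (x : wire m n) : rename (F f) (outer x) = outer x.
  by case: x => [i|j|k] //=; rewrite /F odd_double.
have iF (x : wire p q) : rename (F f) (inner c x) = inner c (rename f x).
  by case: x => [i|j|k] //=; rewrite ?oF // /F /= odd_double /= uphalf_double.
rewrite map_cat (map_nodeE (h := @outer m n)) // perm_cat2l.
move: (perm_map (map_node (inner c)) de).
by rewrite !(map_nodeE (h := inner c \o rename f)).
Qed.

Definition plug_lin (K : fieldType) m n p q (c : context m n p q) :
    lincomb K p q -> lincomb K m n :=
  fglift (fun g : graph p q => << plug c g >> : lincomb K m n).

Section Rules.
Variable K : fieldType.

(* mu (mu (x) id) and mu (id (x) mu) *)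
Definition mu_l : graph 1 3 :=
  graph_of [:: Mu (In 0) (In 1) (Int 0); Mu (Int 0) (In 2) (Out 0)].
Definition mu_r : graph 1 3 :=
  graph_of [:: Mu (In 1) (In 2) (Int 0); Mu (In 0) (Int 0) (Out 0)].

(* (Delta (x) id) Delta and (id (x) Delta) Delta *)
Definition delta_l : graph 3 1 :=
  graph_of [:: Delta (In 0) (Int 0) (Out 2); Delta (Int 0) (Out 0) (Out 1)].
Definition delta_r : graph 3 1 :=
  graph_of [:: Delta (In 0) (Out 0) (Int 0); Delta (Int 0) (Out 1) (Out 2)].

(* Delta mu *)
Definition delta_mu : graph 2 2 :=
  graph_of [:: Mu (In 0) (In 1) (Int 0); Delta (Int 0) (Out 0) (Out 1)].

(* (id (x) mu) (Delta (x) id), i.e. x_1 (x) x_2 y *)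
Definition bt1 : graph 2 2 :=
  graph_of [:: Delta (In 0) (Out 0) (Int 0); Mu (Int 0) (In 1) (Out 1)].
(* (mu (x) id) (id (x) Delta), i.e. x y_1 (x) y_2 *)
Definition bt2 : graph 2 2 :=
  graph_of [:: Delta (In 1) (Int 0) (Out 1); Mu (In 0) (Int 0) (Out 0)].
(* (mu (x) id) (id (x) tau) (Delta (x) id), i.e. x_1 y (x) x_2 *)
Definition bt3 : graph 2 2 :=
  graph_of [:: Delta (In 0) (Int 0) (Out 1); Mu (Int 0) (In 1) (Out 0)].
(* (id (x) mu) (tau (x) id) (id (x) Delta), i.e. y_1 (x) x y_2 *)
Definition bt4 : graph 2 2 :=
  graph_of [:: Delta (In 1) (Out 0) (Int 0); Mu (In 0) (Int 0) (Out 1)].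

(* The parameters a_1, ..., a_4 are [a`_0], ..., [a`_3]. *)
Definition between (a : 4.-tuple K) : lincomb K 2 2 :=
  << delta_mu >> - a`_0 *: << bt1 >> - a`_1 *: << bt2 >>
                 - a`_2 *: << bt3 >> - a`_3 *: << bt4 >>.

(* All relabelings of these rules are obtained in [reduces], where the legs   *)
(* of the hole are attached arbitrarily.                                      *)
Inductive rule (a : 4.-tuple K) : forall p q, graph p q -> lincomb K p q -> Prop :=
| rule_mu : rule a mu_l << mu_r >>
| rule_delta : rule a delta_l << delta_r >>
| rule_between : rule a delta_mu (<< delta_mu >> - between a).

Definition reduces (a : 4.-tuple K) m n (g : graph m n) (r : lincomb K m n) : Prop :=
  exists p q (h : graph p q) (t : lincomb K p q) (c : context m n p q),
    [/\ rule a h t, g = plug c h & r = plug_lin c t].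

Definition step (a : 4.-tuple K) m n (x y : lincomb K m n) : Prop :=
  exists (g : graph m n) (r : lincomb K m n),
    [/\ coeff g x != 0, reduces a g r &
        y = x - coeff g x *: << g >> + coeff g x *: r].

End Rules.

Definition confluent_on (X : Type) (P : X -> Prop) (R : X -> X -> Prop) : Prop :=
  forall x b c : X, P x -> clos_refl_trans X R x b -> clos_refl_trans X R x c ->
  exists d : X, clos_refl_trans X R b d /\ clos_refl_trans X R c d.

(* [free_properad 3] is stable under [step]: the right-hand sides of the      *)
(* rules are connected and acyclic, and a leg of such a graph reaches no      *)
(* other leg than in the left-hand side.                                      *)
Definition induces_confluent (K : fieldType) (a : 4.-tuple K) : Prop :=
  forall m n : nat,
    confluent_on (fun x : lincomb K m n => free_properad 3 x) (@step K a m n).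

Definition in_C (K : fieldType) (b : 4.-tuple K) : Prop :=
  (forall i, tnth b i = tnth b i ^+ 2) /\ (b`_1 * b`_3 = 0 /\ b`_0 * b`_2 = 0).

Definition tilde (K : fieldType) (a : 4.-tuple K) : 4.-tuple K :=
  [tuple a`_1; a`_0; a`_2; a`_3].

(* Main.v *)
(* If every reduction decreases a rank, a linear rewriting system is confluent *)
(* as soon as, for any two reducts of a graph g, every linear form invariant   *)
(* under the reductions of lower rank takes the same value on both: the        *)
(* normal form of any fixed strategy is then invariant under all reductions.   *)
(* Conversely, under confluence the coefficients of such normal forms are      *)
(* linear forms taking the same value on the two reducts.                      *)
(*                                                                             *)
(* Reductions terminate because an acyclic graph carries a current flowing     *)
(* down and one flowing up, whose total energy every rule decreases, whatever  *)
(* the context. Two distinct redexes of a graph with three vertices overlap    *)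
(* in a chain u -> v -> w, one of mu mu mu, mu mu Delta and their images under *)
(* reversal of the arrows, which exchanges the parameters a and tilde a. The   *)
(* pentagon always closes, and the two reducts of Delta(mu(mu (x) id)) differ, *)
(* modulo reductions, by a combination of normal forms whose coefficients are  *)
(* up to sign a_i^2 - a_i, a_1 a_3 and a_2 a_4, so vanish exactly when a is    *)
(* in C.                                                                       *)

From Stdlib Require Import Relation_Operators.
Require Import Defs.
From mathcomp Require Import all_boot all_algebra.
From mathcomp Require Import boolp reals complex.
From mathcomp Require Import zify ring.

Set Implicit Arguments.
Unset Strict Implicit.
Unset Printing Implicit Defensive.

Import GRing.Theory.
Local Open Scope ring_scope.

(** Confluence is reduced to critical pairs by a linear form of Newman's lemma,
    [locally_confluentP]. Reductions lower a rank ([rank_decr]), so it suffices that every linear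
    form invariant under reductions of smaller rank agrees on any two reducts of one graph. Two
    redexes of a graph with three vertices coincide or form a chain u -> v -> w ([redex_overlap]),
    and turning graphs upside down exchanges [a] and [tilde a] ([flip_contract]). Two families of
    chains remain: triple products, where the pentagon closes ([spoly_assoc]), and the coproduct of
    a triple product. Computing Delta((xy)z) in both ways leaves a combination of eight normal forms
    ([spoly_between]) with coefficients, up to sign, a_i^2 - a_i, a_1 a_3 and a_2 a_4. They vanish
    for [a] in C, whence sufficiency ([in_C_confluent]).

    For necessity, confluence forces the two reducts of Delta((xy)z) to have the same normal form
    ([confluent_normalize]). Each intermediate graph listed in [rows_between] has a single redex, so
    its normal form is known for arbitrary [a], and the eight final graphs are irreducible and
    pairwise distinct. Reading off their coefficients gives the equations ([confluent_in_C_upturn]),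
    for [a] from the chain itself and for [tilde a] from its reversal. *)

(** * Formal linear combinations and linear extension *)

Section FormalSums.
Variables (K : fieldType) (G : choiceType).
Implicit Types (x y : {freeg G / K}) (g h : G).

Lemma coeff1 g h : coeff h (<< g >> : {freeg G / K}) = (g == h)%:R.
Proof. by rewrite coeffU mul1r. Qed.

Lemma freegZU (c : K) g : << c *g g >> = c *: << g >> :> {freeg G / K}.
Proof. by apply/eqP/freeg_eqP => h; rewrite coeffZ !coeffU mul1r. Qed.

Lemma freeg_expand x : x = \sum_(g <- dom x) coeff g x *: << g >>.
Proof. by rewrite -[LHS]freeg_sumE; apply: eq_bigr => g _; rewrite freegZU. Qed.

Lemma coeff_sum I (s : seq I) (F : I -> {freeg G / K}) h :
  coeff h (\sum_(i <- s) F i) = \sum_(i <- s) coeff h (F i).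
Proof. exact: raddf_sum. Qed.

Variables (M : lmodType K) (f : G -> M).

Lemma fglift1 g : fglift f << g >> = f g.
Proof. by rewrite liftU scale1r. Qed.

Lemma fgliftB x y : fglift f (x - y) = fglift f x - fglift f y.
Proof. exact: lift_is_additive. Qed.

Lemma fglift0 : fglift f 0 = 0.
Proof. by rewrite -[0 in LHS](subrr 0) fgliftB subrr. Qed.

Lemma fgliftN x : fglift f (- x) = - fglift f x.
Proof. by rewrite -[- x]sub0r fgliftB fglift0 sub0r. Qed.

Lemma fgliftD x y : fglift f (x + y) = fglift f x + fglift f y.
Proof. by rewrite -[y in LHS]opprK fgliftB fgliftN opprK. Qed.

Lemma fglift_sum I (s : seq I) (F : I -> {freeg G / K}) :
  fglift f (\sum_(i <- s) F i) = \sum_(i <- s) fglift f (F i).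
Proof. by elim/big_rec2: _ => [|i x y _ <-]; rewrite ?fglift0 ?fgliftD. Qed.

Lemma fgliftE x : fglift f x = \sum_(g <- dom x) coeff g x *: f g.
Proof.
rewrite -[x in LHS]freeg_sumE fglift_sum.
by apply: eq_bigr => g _; rewrite liftU.
Qed.

Lemma fgliftZ c x : fglift f (c *: x) = c *: fglift f x.
Proof.
rewrite fgliftE [fglift f x]fgliftE scaler_sumr.
have [->|nz_c] := eqVneq c 0.
  by rewrite scale0r dom0 big_nil big1 // => g _; rewrite scale0r.
rewrite (perm_big (dom x)).
  by apply: eq_bigr => g _; rewrite coeffZ scalerA.
by apply: uniq_perm; rewrite ?uniq_dom //; exact: domZ.
Qed.

End FormalSums.

(** * Linear rewriting: normal forms of a strategy and a Newman-type lemma *)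

Section LinearRewriting.
Variables (K : fieldType) (G : choiceType).
Local Notation comb := {freeg G / K}.
Variable red : G -> comb -> Prop.
Implicit Types (x y : comb) (g h : G).

Definition lstep x y := exists g r,
  [/\ coeff g x != 0, red g r & y = x - coeff g x *: << g >> + coeff g x *: r].
Local Notation steps := (clos_refl_trans _ lstep).

Definition supported (P : G -> Prop) x := forall g, coeff g x != 0 -> P g.
Definition irreducible g := forall r, ~ red g r.

Lemma supported1 (P : G -> Prop) g : P g -> supported P << g >>.
Proof.
by move=> Pg h; rewrite coeff1; case: (eqVneq g h) => [<-//|_]; rewrite eqxx.
Qed.

Lemma supported_sum (P : G -> Prop) I (s : seq I) (F : I -> comb) :
  (forall i, supported P (F i)) -> supported P (\sum_(i <- s) F i).
Proof.
move=> sF g; rewrite coeff_sum => nz.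
case: (pselect (P g)) => // nPg; case/negP: nz; rewrite big1 // => i _.
by apply/eqP; apply: contra_notT nPg; exact: sF.
Qed.

Lemma steps_irreducible x y : supported irreducible x -> steps x y -> y = x.
Proof.
move=> + xy; elim: xy => {x y}; last 1 first.
- by move=> x y z _ IHy _ IHz ix; rewrite IHz ?IHy // IHy.
- by move=> x y [g [r [nz rg _]]] /(_ g nz) /(_ r rg).
by [].
Qed.

Variables (P : G -> Prop) (e : G -> nat).
Hypothesis red_decr :
  forall g r h, P g -> red g r -> coeff h r != 0 -> P h /\ (e h < e g)%N.

Variable phi : G -> comb.
Hypothesis phiP : forall g, red g (phi g) \/ phi g = << g >> /\ irreducible g.

Lemma phi_irreducible g : irreducible g -> phi g = << g >>.
Proof. by case: (phiP g) => [rg /(_ _ rg)|[]]. Qed.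

Lemma coeff_phi g h : P g -> h != g -> (e g <= e h)%N -> coeff h (phi g) = 0.
Proof.
move=> Pg; case: (phiP g) => [rg _|[-> _]]; last first.
  by move=> ngh _; rewrite coeff1 eq_sym (negbTE ngh).
rewrite leqNgt; move/negP => neh; apply/eqP; apply/negPn/negP => nz.
by case: neh; case: (red_decr Pg rg nz).
Qed.

(* Processing the support by increasing [e] leaves the coefficients of the    *)
(* graphs still to be processed unchanged.                                    *)
Lemma steps_parallel x (s : seq G) :
  supported P x -> uniq s -> {subset s <= dom x} ->
  pairwise (fun g h => (e g <= e h)%N) s ->
  steps x (x + \sum_(g <- s) coeff g x *: (phi g - << g >>)).
Proof.
move=> Px; elim/last_ind: s => [|s g IHs].
  by rewrite big_nil addr0 => *; exact: rt_refl.
rewrite rcons_uniq pairwise_rcons => /andP[ngs us] sx /andP[egs es].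
have {}IHs : steps x (x + \sum_(g <- s) coeff g x *: (phi g - << g >>)).
  by apply: IHs => // h hs; apply: sx; rewrite mem_rcons inE hs orbT.
set y := _ + _ in IHs.
have cy : coeff g y = coeff g x.
  rewrite coeffD coeff_sum big_seq big1 ?addr0 // => h hs.
  have nhg : g != h by apply: contraNneq ngs => ->.
  rewrite coeffZ coeffB coeff_phi ?coeff1 1?[h == g]eq_sym ?(negbTE nhg) ?subr0 ?mulr0 //.
  - by apply: Px; rewrite -mem_dom; apply: sx; rewrite mem_rcons inE hs orbT.
  - exact: (allP egs).
rewrite -cats1 big_cat big_seq1 addrA -/y -cy /=.
have [->|nz] := eqVneq (coeff g y) 0; first by rewrite scale0r addr0.
case: (phiP g) => [rg|[-> _]]; last by rewrite subrr scaler0 addr0.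
apply: rt_trans IHs _; apply: rt_step; exists g, (phi g); split=> //.
by rewrite scalerBr addrCA addrC.
Qed.

Definition reduce_all x : comb := fglift phi x.

Lemma steps_reduce_all x : supported P x -> steps x (reduce_all x).
Proof.
move=> Px; pose s := sort (fun g h => (e g <= e h)%N) (dom x).
have ps : perm_eq s (dom x) by rewrite perm_sort.
suff -> : reduce_all x = x + \sum_(g <- s) coeff g x *: (phi g - << g >>).
  apply: steps_parallel => //; rewrite ?sort_uniq ?uniq_dom //.
    by move=> g; rewrite mem_sort.
  rewrite -sorted_pairwise; last by move=> g h i; apply: leq_trans.
  by apply: sort_sorted => g h; exact: leq_total.
rewrite (perm_big _ ps) /= (eq_bigr _ (fun g _ => scalerBr _ _ _)) sumrB.
by rewrite -freeg_expand addrC subrK /reduce_all fgliftE.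
Qed.

Lemma supported_reduce_all (Q Q' : G -> Prop) x :
  supported Q x -> (forall g, Q g -> supported Q' (phi g)) ->
  supported Q' (reduce_all x).
Proof.
move=> Qx QQ'; rewrite /reduce_all fgliftE; apply: supported_sum => g h.
by rewrite coeffZ mulf_eq0 negb_or => /andP[/Qx /QQ' Qh]; exact: Qh.
Qed.

Definition below k g := irreducible g \/ P g /\ (e g < k)%N.

Definition normalize k x := iter k reduce_all x.

Lemma steps_normalize k x : supported P x -> steps x (normalize k x).
Proof.
move=> Px; suff [] : steps x (normalize k x) /\ supported P (normalize k x) by [].
elim: k => [|k [xk Pk]]; first by split=> //; exact: rt_refl.
split; first exact: rt_trans xk (steps_reduce_all Pk).
apply: supported_reduce_all Pk _ => g Pg h; case: (phiP g) => [rg|[-> _]].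
  by move=> nz; case: (red_decr Pg rg nz).
exact: supported1.
Qed.

Lemma reduce_all_irreducible x : supported irreducible x -> reduce_all x = x.
Proof.
move=> ix; rewrite /reduce_all fgliftE [RHS]freeg_expand.
by apply: eq_big_seq => g; rewrite mem_dom => /ix ig; rewrite phi_irreducible.
Qed.

(** Each parallel round lowers the rank bound by one, so after [k] rounds only irreducible graphs
    survive. *)
Lemma normalize_irreducible k x :
  supported (below k) x -> supported irreducible (normalize k x).
Proof.
elim: k x => [|k IHk] x bx; first by move=> g /bx[//|[]].
rewrite /normalize iterSr; apply: IHk; apply: supported_reduce_all bx _ => g.
move=> [ig|[Pg eg]] h.
  by rewrite phi_irreducible //; apply: supported1; left.
case: (phiP g) => [rg /(red_decr Pg rg)[Ph eh]|[-> ig]].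
  by right; split=> //; apply: leq_trans eh _.
by apply: supported1; left.
Qed.

Lemma normalize_reduce_all k x :
  supported (below k) x -> normalize k (reduce_all x) = normalize k x.
Proof.
move=> bx; rewrite /normalize -iterSr iterS reduce_all_irreducible //.
exact: normalize_irreducible.
Qed.

(** These are the linear forms to which local confluence is applied. *)
Definition normal_coeff k h g : K^o := coeff h (normalize k << g >>).

Lemma coeff_normalize k h x :
  coeff h (normalize k x) = fglift (normal_coeff k h) x.
Proof.
have nE : normalize k x = fglift (fun g => normalize k << g >>) x.
  elim: k => [|k IHk]; first by rewrite fgliftE -freeg_expand.
  rewrite [LHS]/(reduce_all (normalize k x)) IHk !(fgliftE _ x) /reduce_all fglift_sum.
  by apply: eq_bigr => g _; rewrite fgliftZ.
rewrite nE !fgliftE coeff_sum; apply: eq_bigr => g _; exact: coeffZ.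
Qed.

Lemma normalize_red k g r : below k g -> red g r -> phi g = r ->
  normalize k << g >> = normalize k r.
Proof.
move=> bg rg pg; rewrite -normalize_reduce_all ?/reduce_all ?fglift1 ?pg //.
exact: supported1.
Qed.

Lemma normalize_fix k x : supported irreducible x -> normalize k x = x.
Proof.
move=> ix; elim: k => // k IHk.
by rewrite /normalize iterS [iter _ _ _]IHk reduce_all_irreducible.
Qed.

(** Both reducts descend to irreducible combinations, and a common descendant of irreducible
    combinations is equal to each of them. *)
Lemma confluent_normalize k g r r' : P g -> (e g <= k)%N -> red g r -> red g r' ->
  (forall b c, steps << g >> b -> steps << g >> c ->
     exists d, steps b d /\ steps c d) ->
  normalize k r = normalize k r'.
Proof.
move=> Pg egk gr gr' conf.
have step1 s : red g s -> steps << g >> s.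
  move=> gs; apply: rt_step; exists g, s; rewrite coeff1 eqxx !scale1r subrr add0r.
  by split=> //; exact: oner_neq0.
have Ps s : red g s -> supported P s by move=> gs h nz; case: (red_decr Pg gs nz).
have bs s : red g s -> supported (below k) s.
  move=> gs h nz; right; have [Ph eh] := red_decr Pg gs nz.
  by split=> //; exact: leq_trans eh egk.
have to_nf s : red g s -> steps << g >> (normalize k s).
  by move=> gs; apply: rt_trans (step1 _ gs) (steps_normalize _ (Ps _ gs)).
have [d [rd r'd]] := conf _ _ (to_nf _ gr) (to_nf _ gr').
rewrite -(steps_irreducible _ rd); last exact/normalize_irreducible/bs.
by rewrite -(steps_irreducible _ r'd) //; exact/normalize_irreducible/bs.
Qed.

Hypothesis locally_confluent : forall g r r', P g -> red g r -> red g r' ->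
  forall L : G -> K^o,
    (forall g' s, P g' -> (e g' < e g)%N -> red g' s -> L g' = fglift L s) ->
  fglift L r = fglift L r'.

(** Strong induction on the rank: the coefficients of the normal form are already invariant below
    [g], so local confluence lets [r] be compared with the reduct [phi g] chosen by the strategy. *)
Lemma normalize_invariant k g r : P g -> (e g < k)%N -> red g r ->
  normalize k r = normalize k << g >>.
Proof.
move en: (e g) => n; elim/ltn_ind: n g r en => n IH g r en Pg ek rg.
case: (phiP g) => [rg'|[_ /(_ r)//]].
rewrite (@normalize_red k g (phi g)) //; last by right; split; rewrite ?en.
apply/eqP/freeg_eqP => h; rewrite !coeff_normalize.
apply: locally_confluent Pg rg rg' _ _ => g' s Pg' eg' rg''.
rewrite en in eg'; rewrite -coeff_normalize (IH (e g') eg' g') //.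
exact: ltn_trans eg' ek.
Qed.

Lemma bounded_support x : exists k, forall g, coeff g x != 0 -> (e g < k)%N.
Proof.
exists (\sum_(g <- dom x) e g).+1 => g; rewrite -mem_dom ltnS => gx.
by rewrite (bigD1_seq g) ?uniq_dom //= leq_addr.
Qed.

Theorem locally_confluentP : confluent_on (supported P) lstep.
Proof.
move=> x b c Px xb xc; have [k ek] := bounded_support x.
pose Pk g := P g /\ (e g < k)%N.
(* Any sequence of steps preserves the rank bound and the normal form, so [normalize k x] is a
   common descendant of [b] and [c]. *)
have inv y z : steps y z -> supported Pk y ->
    supported Pk z /\ normalize k z = normalize k y.
  elim=> {y z} [y z [g [r [nz rg ->]]] Py|//|y z t _ IHz _ IHt /IHz[/IHt[Pt ->] ->]//].
  have [Pg eg] := Py g nz; split.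
    move=> h; rewrite coeffD coeffB !coeffZ.
    have [->|nr] := eqVneq (coeff h r) 0; last first.
      have [Ph eh] := red_decr Pg rg nr; split=> //; exact: ltn_trans eh eg.
    rewrite mulr0 addr0 coeff1; case: (eqVneq g h) => [<-//|_].
    by rewrite mulr0 subr0; exact: Py.
  apply/eqP/freeg_eqP => h; rewrite !coeff_normalize fgliftD fgliftB !fgliftZ.
  have := congr1 (coeff h) (normalize_invariant Pg eg rg).
  by rewrite !coeff_normalize => ->; rewrite subrK.
have Pkx : supported Pk x by move=> g nz; split; [exact: Px|exact: ek].
have [Pb nb] := inv _ _ xb Pkx; have [Pc nc] := inv _ _ xc Pkx.
have P_of y : supported Pk y -> supported P y by move=> Py g /Py[].
exists (normalize k x); split.
  by rewrite -nb; apply: steps_normalize; exact: P_of.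
by rewrite -nc; apply: steps_normalize; exact: P_of.
Qed.

End LinearRewriting.

(** * Diagrams up to renaming, redexes and contractions *)

(** Isomorphisms of diagrams use bijections of all names, whereas natural renamings such as doubling
    are only injective; on the finitely many names that occur, the two are interchangeable. *)
Lemma bijective_extension (s t : seq nat) : uniq s -> uniq t -> size s = size t ->
  exists2 f : nat -> nat, bijective f & map f s = t.
Proof.
elim: s t => [|x s IHs] [|y t] //=; first by exists id => //; exists id.
move=> /andP[xs us] /andP[yt ut] [/(IHs t us ut)[f bf fs]].
pose sw (z : nat) := if z == f x then y else if z == y then f x else z.
have swK : involutive sw.
  rewrite /sw => z; have [->|zx] := eqVneq z (f x).
    by rewrite eqxx; case: (eqVneq y (f x)).
  by have [->|zy] := eqVneq z y; rewrite ?eqxx ?(negbTE zx) ?(negbTE zy).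
exists (sw \o f) => /=; first by apply: bij_comp bf; exists sw.
rewrite /sw eqxx; congr (_ :: _); rewrite -fs; apply/eq_in_map => z zs /=.
have [/(bij_inj bf) zx|_] := eqVneq (f z) (f x); first by rewrite -zx zs in xs.
by case: (eqVneq (f z) y) => // fzy; rewrite -fzy -fs map_f in yt.
Qed.

Definition wires W (v : node W) : seq W := ins v ++ outs v.

Lemma map_node_in (W W' : eqType) (f g : W -> W') (v : node W) :
  {in wires v, f =1 g} -> map_node f v = map_node g v.
Proof.
by case: v => x y z fg /=; rewrite (fg x) 1?(fg y) 1?(fg z) // !inE eqxx ?orbT.
Qed.

Section Graphs.
Variables m n : nat.
Local Notation wire := (wire m n).
Local Notation diagram := (diagram m n).
Implicit Types (d e o : diagram) (u v : node wire) (w x y z t : wire).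

Definition rename_diagram (f : nat -> nat) d : diagram := map (map_node (rename f)) d.

Lemma graph_ofP d e : graph_of d = graph_of e <-> iso d e.
Proof. by split=> [/eqmodP|de]; last exact/eqmodP. Qed.

Lemma graph_of_perm d e : perm_eq d e -> graph_of d = graph_of e.
Proof.
move=> de; apply/graph_ofP/asboolP; exists id; split; first by exists id.
by rewrite map_node_id //; case.
Qed.

Lemma graph_of_rename f d : injective f -> graph_of (rename_diagram f d) = graph_of d.
Proof.
move=> injf; apply/esym/graph_ofP/asboolP.
pose s := undup (pmap (fun w => if w is Int k then Some k else None)
                      (flatten (map (@wires _) d))).
have [g bg gs] : exists2 g : nat -> nat, bijective g & map g s = map f s.
  by apply: bijective_extension; rewrite ?size_map ?map_inj_uniq ?undup_uniq.
exists g; split=> //; have /eq_in_map {}gs := gs.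
rewrite (_ : map _ d = rename_diagram f d) //; apply/eq_in_map => v vd.
apply: map_node_in => -[i|j|k] //= kv; rewrite gs // mem_undup mem_pmap.
apply/mapP; exists (Int k) => //.
by apply/flattenP; exists (wires v) => //; exact: map_f.
Qed.

(** The part of well-wiredness carried along reductions: a wire has at most one source and one
    target, hence determines its end vertices. *)
Definition linear_diagram d :=
  uniq (flatten (map (@ins _) d)) && uniq (flatten (map (@outs _) d)).

Lemma linear_perm d e : perm_eq d e -> linear_diagram d = linear_diagram e.
Proof.
move=> de; rewrite /linear_diagram.
by rewrite !(perm_uniq (perm_flatten (perm_map _ de))).
Qed.

Lemma linear_uniq d : linear_diagram d -> uniq d.
Proof.
move=> /andP[li _]; apply: (@map_uniq _ _ (fun s => head (Int 0) (ins s))); move: li.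
elim: d => //= s d IH; rewrite cat_uniq => /and3P[_ sd /IH->]; rewrite andbT.
apply: contra sd => /mapP[t td st]; apply/hasP; exists (head (Int 0) (ins s)).
  apply/flattenP; exists (ins t); first exact: map_f.
  by rewrite st; case: t {td st} => x y z; rewrite inE eqxx.
by case: s {st} => x y z; rewrite inE eqxx.
Qed.

Lemma flatten_map_rename (h : forall W, node W -> seq W) f d :
  (forall v, h _ (map_node (rename f) v) = map (rename f) (h _ v)) ->
  flatten (map (h _) (rename_diagram f d)) = map (rename f) (flatten (map (h _) d)).
Proof.
by move=> hf; rewrite map_flatten -!map_comp; congr flatten; apply: eq_map => v /=.
Qed.

Lemma rename_inj f : injective f -> injective (@rename m n f).
Proof. by move=> fI [i|j|k] [i'|j'|k'] // [/fI->]. Qed.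

Lemma linear_rename f d : injective f ->
  linear_diagram (rename_diagram f d) = linear_diagram d.
Proof.
move=> fI; rewrite /linear_diagram (flatten_map_rename (h := ins)); last by case.
rewrite (flatten_map_rename (h := outs)); last by case.
by rewrite !map_inj_uniq //; exact: rename_inj.
Qed.

(** In every left-hand side the first output of one vertex is the first input of the next; no rule
    has a coproduct followed by a product. *)
Definition redex u v : bool :=
  match u, v with
  | Mu _ _ (Int k), Mu (Int j) _ _ | Mu _ _ (Int k), Delta (Int j) _ _
  | Delta _ (Int k) _, Delta (Int j) _ _ => k == j
  | _, _ => false
  end.

Section Contraction.
Variables (K : fieldType) (a : 4.-tuple K).

(** The name of the removed internal wire is recycled for the internal wire of each term on the
    right. *)
Definition contract u v : seq (K * diagram) :=
  match u, v with
  | Mu x y k, Mu _ z t => [:: (1, [:: Mu y z k; Mu x k t])]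
  | Delta x k z, Delta _ y t => [:: (1, [:: Delta x y k; Delta k t z])]
  | Mu x y k, Delta _ z t =>
    [:: (a`_0, [:: Delta x z k; Mu k y t]); (a`_1, [:: Delta y k t; Mu x k z]);
        (a`_2, [:: Delta x k t; Mu k y z]); (a`_3, [:: Delta y z k; Mu x k t])]
  | Delta _ _ _, Mu _ _ _ => [::]
  end.

Definition contraction u v o : lincomb K m n :=
  \sum_(p <- contract u v) p.1 *: << graph_of (p.2 ++ o) >>.

Variant redex_spec : node wire -> node wire -> seq (K * diagram) -> Type :=
| RedexMu x y z t k : redex_spec (Mu x y (Int k)) (Mu (Int k) z t)
    [:: (1, [:: Mu y z (Int k); Mu x (Int k) t])]
| RedexDelta x y z t k : redex_spec (Delta x (Int k) z) (Delta (Int k) y t)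
    [:: (1, [:: Delta x y (Int k); Delta (Int k) t z])]
| RedexMuDelta x y z t k : redex_spec (Mu x y (Int k)) (Delta (Int k) z t)
    [:: (a`_0, [:: Delta x z (Int k); Mu (Int k) y t]);
        (a`_1, [:: Delta y (Int k) t; Mu x (Int k) z]);
        (a`_2, [:: Delta x (Int k) t; Mu (Int k) y z]);
        (a`_3, [:: Delta y z (Int k); Mu x (Int k) t])].

Lemma redexP u v : redex u v -> redex_spec u v (contract u v).
Proof.
by case: u v => [x y [i|j|k]|x [i|j|k] z] [[i'|j'|k'] y' z'|[i'|j'|k'] y' z'] //=
  /eqP <-; constructor.
Qed.

Lemma between_rhs :
  << delta_mu >> - between a = a`_0 *: << bt1 >> + a`_1 *: << bt2 >>
    + a`_2 *: << bt3 >> + a`_3 *: << bt4 >>.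
Proof. by rewrite /between !opprD !opprK !addrA subrr add0r. Qed.

Lemma plug_rename p q (c : context m n p q) f (e : Defs.diagram p q) : injective f ->
  plug c (graph_of e) = graph_of
    (rename_diagram f (map (map_node (inner c)) e)
       ++ rename_diagram f (map (map_node (@outer m n)) (others c))).
Proof.
move=> fI; rewrite plug_graph_of -(graph_of_rename _ fI).
by apply: graph_of_perm; rewrite /rename_diagram map_cat perm_catC.
Qed.

Lemma plug_lin1 p q (c : context m n p q) h :
  plug_lin c << h >> = << plug c h >> :> lincomb K m n.
Proof. exact: fglift1. Qed.

(** The isomorphism from the plugged diagram to [d] carries the two vertices of the rule to [u] and
    [v], and its context to [o]. *)
Lemma reduces_inv d g r : reduces a g r -> graph_of d = g ->
  exists u v o, [/\ perm_eq d [:: u, v & o], redex u v & r = contraction u v o].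
Proof.
move=> [p [q [h [t [c [ht -> ->]]]]]].
case: {p q h t} ht c => c; rewrite plug_graph_of => /esym/graph_ofP/asboolP[f [bf df]];
  have fI := bij_inj bf.
- exists (map_node (rename f) (map_node (inner c) (Mu (In 0) (In 1) (Int 0)))).
  exists (map_node (rename f) (map_node (inner c) (Mu (Int 0) (In 2) (Out 0)))).
  exists (rename_diagram f (map (map_node (@outer m n)) (others c))); split.
  + by rewrite perm_sym; apply: perm_trans df; rewrite perm_sym map_cat perm_catC.
  + exact: eqxx.
  + by rewrite plug_lin1 (plug_rename _ _ fI) /contraction big_seq1 scale1r.
- exists (map_node (rename f) (map_node (inner c) (Delta (In 0) (Int 0) (Out 2)))).
  exists (map_node (rename f) (map_node (inner c) (Delta (Int 0) (Out 0) (Out 1)))).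
  exists (rename_diagram f (map (map_node (@outer m n)) (others c))); split.
  + by rewrite perm_sym; apply: perm_trans df; rewrite perm_sym map_cat perm_catC.
  + exact: eqxx.
  + by rewrite plug_lin1 (plug_rename _ _ fI) /contraction big_seq1 scale1r.
- exists (map_node (rename f) (map_node (inner c) (Mu (In 0) (In 1) (Int 0)))).
  exists (map_node (rename f) (map_node (inner c) (Delta (Int 0) (Out 0) (Out 1)))).
  exists (rename_diagram f (map (map_node (@outer m n)) (others c))); split.
  + by rewrite perm_sym; apply: perm_trans df; rewrite perm_sym map_cat perm_catC.
  + exact: eqxx.
  + rewrite between_rhs /plug_lin !fgliftD !fgliftZ !fglift1.
    rewrite !(plug_rename _ _ fI) /contraction !big_cons big_nil addr0 !addrA.
    by [].
Qed.

End Contraction.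
End Graphs.

(** * Contractions of linear diagrams are reductions *)

Section Introduction.
Variables (m n : nat).
Local Notation wire := (wire m n).
Local Notation diagram := (diagram m n).
Implicit Types (d e o : diagram) (u v : node wire) (w x y z t : wire).

Definition fill p q (c : context m n p q) k (w : Defs.wire p q) : wire :=
  match w with In i => hole_in c i | Out j => hole_out c j | Int _ => Int k end.

Lemma plug_fill p q (c : context m n p q) k (e : Defs.diagram p q) :
  (forall i, hole_in c i != Int k) -> (forall j, hole_out c j != Int k) ->
  all (fun v => Int k \notin wires v) (others c) ->
  all (fun s => all (fun i => if i is Int j then j == 0%N else true) (wires s)) e ->
  plug c (graph_of e) = graph_of (map (map_node (fill c k)) e ++ others c).
Proof.
(* Plugging gives the inner wire 0 the odd name 1 and doubles the names of the context; [f]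
   reproduces this with [k] as the inner wire. *)
move=> ik jk ok ek; pose f j := if j == k then 1%N else j.*2.
have fI : injective f.
  move=> i j; rewrite /f; case: eqVneq => [->|ni]; case: eqVneq => [->|nj] //.
  - by move=> /(congr1 odd); rewrite odd_double.
  - by move=> /(congr1 odd); rewrite odd_double.
  - exact: double_inj.
have outerE w : w != Int k -> outer w = rename f w.
  case: w => [i|j|j] //= njk; rewrite /f; case: eqVneq => // jk'.
  by rewrite jk' eqxx in njk.
rewrite plug_graph_of -[RHS](graph_of_rename _ fI); apply: graph_of_perm.
rewrite /plug_diagram /rename_diagram map_cat perm_catC.
rewrite (_ : map _ e = map (map_node (rename f)) (map (map_node (fill c k)) e)).
  rewrite (_ : map _ (others c) = map (map_node (rename f)) (others c)) //.
    apply/eq_in_map => v /(allP ok) kv; apply: map_node_in => w wv.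
  by apply: outerE; apply: contraNneq kv => <-.
rewrite -map_comp; apply/eq_in_map => v /(allP ek)/allP kv.
transitivity (map_node (rename f \o fill c k) v); last by case: v {kv}.
apply: map_node_in => -[i|j|j] wv /=; rewrite ?outerE //.
by rewrite (eqP (kv _ wv)) /f eqxx.
Qed.

Lemma linear_count d w : linear_diagram d ->
  (count_mem w (flatten (map (@ins _) d)) <= 1)%N /\
  (count_mem w (flatten (map (@outs _) d)) <= 1)%N.
Proof. by move=> /andP[ui uo]; rewrite !count_uniq_mem // !leq_b1. Qed.

Lemma fresh_count o w : count_mem w (flatten (map (@ins _) o)) = 0%N ->
  count_mem w (flatten (map (@outs _) o)) = 0%N ->
  all (fun v => w \notin wires v) o.
Proof.
move=> /count_memPn wi /count_memPn wo; apply/allP => v vo.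
rewrite mem_cat negb_or; apply/andP; split.
  by apply: contra wi => wv; apply/flattenP; exists (ins v) => //; exact: map_f.
by apply: contra wo => wv; apply/flattenP; exists (outs v) => //; exact: map_f.
Qed.

Variables (K : fieldType) (a : 4.-tuple K).

(** Linearity ensures that the wire joining [u] and [v] occurs nowhere else, so the remaining
    vertices form a context for the rule. *)
Lemma reduces_intro u v o : linear_diagram [:: u, v & o] -> redex u v ->
  reduces a (graph_of [:: u, v & o]) (contraction a u v o).
Proof.
rewrite /contraction => + uv; case: (redexP a uv) => x y z t k /(linear_count (Int k)) /=;
  rewrite eqxx => -[ki ko].
- pose c := Context o (fun i : 'I_3 => nth x [:: x; y; z] i) (fun _ : 'I_1 => t).
  have fillE h : all (fun s => all (fun i => if i is Int j then j == 0%N else true) (wires s)) h ->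
      plug c (graph_of h) = graph_of (map (map_node (fill c k)) h ++ o).
    apply: plug_fill.
    + by case=> -[|[|[|//]]] /= _; apply/eqP => E; move: ki; rewrite E eqxx /=; lia.
    + by move=> _ /=; apply/eqP => E; move: ko; rewrite E eqxx /=; lia.
    + apply: fresh_count => /=; lia.
  exists 1%N, 3%N, mu_l, << mu_r >>, c; split; first exact: rule_mu.
    by rewrite fillE.
  by rewrite plug_lin1 fillE // big_seq1 scale1r.
- pose c := Context o (fun _ : 'I_1 => x) (fun i : 'I_3 => nth x [:: y; t; z] i).
  have fillE h : all (fun s => all (fun i => if i is Int j then j == 0%N else true) (wires s)) h ->
      plug c (graph_of h) = graph_of (map (map_node (fill c k)) h ++ o).
    apply: plug_fill.
    + by move=> _ /=; apply/eqP => E; move: ki; rewrite E eqxx /=; lia.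
    + by case=> -[|[|[|//]]] /= _; apply/eqP => E; move: ko; rewrite E eqxx /=; lia.
    + apply: fresh_count => /=; lia.
  exists 3%N, 1%N, delta_l, << delta_r >>, c; split; first exact: rule_delta.
    by rewrite fillE.
  by rewrite plug_lin1 fillE // big_seq1 scale1r.
- pose c := Context o (fun i : 'I_2 => nth x [:: x; y] i) (fun i : 'I_2 => nth z [:: z; t] i).
  have fillE h : all (fun s => all (fun i => if i is Int j then j == 0%N else true) (wires s)) h ->
      plug c (graph_of h) = graph_of (map (map_node (fill c k)) h ++ o).
    apply: plug_fill.
    + by case=> -[|[|//]] /= _; apply/eqP => E; move: ki; rewrite E eqxx /=; lia.
    + by case=> -[|[|//]] /= _; apply/eqP => E; move: ko; rewrite E eqxx /=; lia.
    + apply: fresh_count => /=; lia.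
  exists 2%N, 2%N, delta_mu, (<< delta_mu >> - between a), c; split.
  + exact: rule_between.
  + by rewrite fillE.
  + rewrite between_rhs /plug_lin !fgliftD !fgliftZ !fglift1.
    by rewrite !fillE // !big_cons big_nil addr0 !addrA.
Qed.

End Introduction.

(** * Termination by the energy of currents *)

Section Termination.
Variables (m n : nat).
Local Notation wire := (wire m n).
Local Notation diagram := (diagram m n).
Implicit Types (d e o : diagram) (s u : node wire) (x y z t : wire).
Implicit Types v w : wire -> nat.

(* Currents [v] flow from the inputs to the outputs and currents [w] from the *)
(* outputs to the inputs; as [w x - v x] strictly decreases along every       *)
(* vertex, the diagrams carrying currents are acyclic.                        *)
Definition currents v w s : bool :=
  match s with
  | Mu x y z => [&& v x + v y < v z, w z <= w x & w z <= w y]%N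
  | Delta x y z => [&& v x <= v y, v x <= v z & w y + w z < w x]%N
  end.

Definition node_energy v w s : nat :=
  match s with Mu x _ z => v x + w z | Delta x y _ => v x + w y end.

Definition energy v w d : nat := \sum_(s <- d) node_energy v w s.

Definition has_energy d k : Prop := [/\ size d = 3%N, linear_diagram d &
  exists v w, all (currents v w) d /\ energy v w d = k].

Lemma has_energy_perm d e k : perm_eq d e -> has_energy d k -> has_energy e k.
Proof.
move=> de [sd ld [v [w [cd ed]]]]; split.
- by rewrite -(perm_size de).
- by rewrite -(linear_perm de).
- by exists v, w; rewrite -(perm_all _ de) /energy -(perm_big _ de).
Qed.

Lemma has_energy_rename f d k : bijective f ->
  has_energy d k -> has_energy (rename_diagram f d) k.
Proof.
move=> bf [sd ld [v [w [cd ed]]]]; split.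
- by rewrite size_map.
- by rewrite linear_rename //; exact: bij_inj.
case: bf => g fK gK; exists (v \o rename g), (w \o rename g).
have rK : cancel (@rename m n f) (rename g) by case=> //= i; rewrite fK.
rewrite all_map /energy big_map; split.
  by apply: sub_all cd => -[x y z|x y z] /=; rewrite !rK.
by rewrite -ed; apply: eq_bigr => -[x y z|x y z] _ /=; rewrite !rK.
Qed.

Lemma has_energy_graph d e k : graph_of d = graph_of e ->
  has_energy d k -> has_energy e k.
Proof.
move=> /graph_ofP/asboolP[f [bf de]] /(has_energy_rename bf).
exact: has_energy_perm de.
Qed.

Lemma energy_cons v w s d : energy v w (s :: d) = (node_energy v w s + energy v w d)%N.
Proof. exact: big_cons. Qed.

Definition update v j c x : nat := if x == Int j then c else v x.

Lemma update_eq v j c : update v j c (Int j) = c.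
Proof. by rewrite /update eqxx. Qed.

Lemma update_neq v j c x : (x == Int j) = false -> update v j c x = v x.
Proof. by rewrite /update => ->. Qed.

Lemma currents_update v w j c c' q o k : all (fun s => Int j \notin wires s) o ->
  all (currents v w) o -> all (currents (update v j c) (update w j c')) q ->
  (energy (update v j c) (update w j c') q + energy v w o < k)%N ->
  exists v' w', all (currents v' w') (q ++ o) /\ (energy v' w' (q ++ o) < k)%N.
Proof.
move=> jo co cq eqk; exists (update v j c), (update w j c').
have E s : s \in o ->
    currents (update v j c) (update w j c') s = currents v w s /\
    node_energy (update v j c) (update w j c') s = node_energy v w s.
  move=> /(allP jo) js.
  have uE v1 b x : x \in wires s -> update v1 j b x = v1 x.
    by move=> xs; apply: update_neq; apply: contraNF js => /eqP <-.
  by case: s {js} uE => x y z uE /=; rewrite !uE // !inE eqxx ?orbT.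
have {}co : all (currents (update v j c) (update w j c')) o.
  by apply/allP => s so; have [-> _] := E s so; exact: (allP co).
have eo : energy (update v j c) (update w j c') o = energy v w o.
  by rewrite /energy !big_seq; apply: eq_bigr => s /E[].
by rewrite all_cat cq co /energy big_cat /= -!/(energy _ _ _) eo.
Qed.

Variables (K : fieldType) (a : 4.-tuple K).

Lemma contract_linear (u s : node wire) o p : redex u s -> p \in contract a u s ->
  linear_diagram (p.2 ++ o) = linear_diagram [:: u, s & o] /\
  size (p.2 ++ o) = size [:: u, s & o].
Proof.
move=> us; rewrite /linear_diagram !map_cat !flatten_cat.
case: (redexP a us) => x y z t k; rewrite !inE.
- move=> /eqP->; split=> //; congr (_ && _).
  by apply: perm_uniq; apply/permP => q /=; lia.
- move=> /eqP->; split=> //; congr (_ && _).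
  by apply: perm_uniq; apply/permP => q /=; lia.
- by move=> /or4P[] /eqP->; split=> //; congr (_ && _);
    apply: perm_uniq; apply/permP => q /=; lia.
Qed.

(** Only the internal wire changes its two values, so the rest of the diagram still carries the
    currents. It receives the least values compatible with the new vertices; a [.+1] comes from the
    strict inequality at a product or a coproduct. *)
Lemma contract_energy (u s : node wire) o p k :
  redex u s -> has_energy [:: u, s & o] k -> p \in contract a u s ->
  exists2 k', (k' < k)%N & has_energy (p.2 ++ o) k'.
Proof.
move=> us [so lo [v [w [co eo]]]] ps.
have [lp sp] := contract_linear o us ps.
suff [v' [w' [cp ep]]] : exists v' w',
    all (currents v' w') (p.2 ++ o) /\ (energy v' w' (p.2 ++ o) < k)%N.
  by exists (energy v' w' (p.2 ++ o)) => //; split; rewrite ?lp ?sp //; exists v', w'.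
move: co eo; rewrite !energy_cons /=.
case: (redexP a us) ps lo => x y z t j ps /(linear_count (Int j)) /=;
  rewrite eqxx => -[li lj];
  have fo : all (fun s => Int j \notin wires s) o by apply: fresh_count => /=; lia.
all: have ne q : (q \in [:: x; y; z; t]) -> (q == Int j) = false
  by rewrite !inE => /or4P[] /eqP->; apply/negP => /eqP E;
     move: li lj; rewrite E eqxx /=; lia.
all: have [xj yj zj tj] : [/\ (x == Int j) = false, (y == Int j) = false,
    (z == Int j) = false & (t == Int j) = false]
  by split; apply: ne; rewrite !inE eqxx ?orbT.
all: move: ps; rewrite !inE.
- move=> /eqP-> /and3P[cu cs co] <-.
  apply: (currents_update (c := (v y + v z).+1) (c' := w t) fo co);
    rewrite ?energy_cons ?/energy ?big_nil /= ?update_eq ?update_neq //; lia.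
- move=> /eqP-> /and3P[cu cs co] <-.
  apply: (currents_update (c := v x) (c' := (w t + w z).+1) fo co);
    rewrite ?energy_cons ?/energy ?big_nil /= ?update_eq ?update_neq //; lia.
- move=> /or4P[] /eqP-> /and3P[cu cs co] <-.
  + apply: (currents_update (c := v x) (c' := w t) fo co);
    rewrite ?energy_cons ?/energy ?big_nil /= ?update_eq ?update_neq //; lia.
  + apply: (currents_update (c := v y) (c' := w z) fo co);
    rewrite ?energy_cons ?/energy ?big_nil /= ?update_eq ?update_neq //; lia.
  + apply: (currents_update (c := v x) (c' := w z) fo co);
    rewrite ?energy_cons ?/energy ?big_nil /= ?update_eq ?update_neq //; lia.
  + apply: (currents_update (c := v y) (c' := w t) fo co);
    rewrite ?energy_cons ?/energy ?big_nil /= ?update_eq ?update_neq //; lia.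
Qed.

(** Implied by being properadic of weight 3 and stable under reduction, so that connectedness and
    full well-wiredness need not be followed. *)
Definition tractable (g : graph m n) : Prop := exists k, has_energy (repr g) k.

(** The least energy over all choices of currents; the value 0 for graphs without currents is a
    default. *)
Definition rank (g : graph m n) : nat :=
  if pselect (exists k, `[< has_energy (repr g) k >]) is left H then ex_minn H else 0.

Lemma has_energy_repr d k : has_energy (repr (graph_of d)) k <-> has_energy d k.
Proof. by split; apply: has_energy_graph; rewrite /graph_of reprK. Qed.

Lemma rankP g : tractable g ->
  has_energy (repr g) (rank g) /\ forall k, has_energy (repr g) k -> (rank g <= k)%N.
Proof.
move=> [k gk]; rewrite /rank; case: pselect => [H|[]]; last by exists k; exact/asboolP.
case: ex_minnP => k' /asboolP gk' mink'; split=> // k1 /asboolP; exact: mink'.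
Qed.

Lemma rank_decr (u s : node wire) o p :
  tractable (graph_of [:: u, s & o]) -> redex u s -> p \in contract a u s ->
  tractable (graph_of (p.2 ++ o)) /\
  (rank (graph_of (p.2 ++ o)) < rank (graph_of [:: u, s & o]))%N.
Proof.
move=> /rankP[/has_energy_repr dk _] us ps.
have [k kd pk] := contract_energy us dk ps.
have {}pk : has_energy (repr (graph_of (p.2 ++ o))) k by exact/has_energy_repr.
have tp : tractable (graph_of (p.2 ++ o)) by exists k.
by split=> //; apply: leq_ltn_trans kd; apply: (proj2 (rankP tp)).
Qed.

End Termination.

(** * Acyclic diagrams carry currents *)

Section Heights.
Variables (T : finType) (r : rel T).
Hypothesis acyclic_r : forall x y, r x y -> ~~ connect r y x.

Definition height x := #|[pred y | connect r y x]|.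

Lemma height_lt x y : r x y -> (height x < height y)%N.
Proof.
move=> xy; apply: proper_card; apply/properP; split.
  by apply/subsetP => z; rewrite !inE => /connect_trans; apply; exact: connect1.
by exists y; rewrite !inE ?connect0 //; exact: acyclic_r.
Qed.

(** A wire leaving [x] gets a value at least 3^(height x + 1), while a wire entering [x] leaves only
    vertices of smaller height and gets at most 3^(height x). Base 3 makes each outgoing value
    exceed the sum of two incoming ones. *)
Lemma height_flow (W : eqType) (src tgt : T -> seq W) :
  (forall x y, has (mem (tgt y)) (src x) -> r x y) ->
  exists v : W -> nat, forall x, exists b,
    {in tgt x, forall i, (v i <= b)%N} /\ {in src x, forall i, (2 * b < v i)%N}.
Proof.
move=> rP; pose v i := \max_(x | i \in src x) 3 ^ (height x).+1; exists v => x.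
exists (3 ^ height x)%N; split=> i ix.
  apply/bigmax_leqP => y iy; rewrite leq_exp2l // height_lt //.
  by apply: rP; apply/hasP; exists i.
apply: (@leq_trans (3 ^ (height x).+1)%N).
  by rewrite expnS ltn_mul2r expn_gt0.
exact: (@leq_bigmax_cond _ _ (fun x => 3 ^ (height x).+1)%N).
Qed.

End Heights.

Lemma acyclic_currents m n (d : diagram m n) : acyclic d ->
  exists v w, all (currents v w) d.
Proof.
move=> ac; have [v vP] := height_flow ac (fun x y xy => xy).
pose r' : rel 'I_(size d) := [rel x y | feeds y x].
have ac' x y : r' x y -> ~~ connect r' y x.
  by move=> /ac; rewrite (connect_rev (@feeds m n d)).
have r'P x y : has (mem (outs (tnth (in_tuple d) y))) (ins (tnth (in_tuple d) x)) -> r' x y.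
  by move=> /hasP[i ix iy]; apply/hasP; exists i.
have [w wP] := height_flow ac' r'P.
exists v, w; apply/(all_tnthP (t := in_tuple d)) => i.
move: (vP i) (wP i); case: (tnth (in_tuple d) i) => x y z /= [b [vi vo]] [c [wi wo]].
- have := vi x; have := vi y; have := vo z; have := wi z; have := wo x; have := wo y.
  by rewrite !inE !eqxx ?orbT => /(_ isT) + /(_ isT) + /(_ isT) + /(_ isT) + /(_ isT) + /(_ isT); lia.
- have := vi x; have := vo y; have := vo z; have := wi y; have := wi z; have := wo x.
  by rewrite !inE !eqxx ?orbT => /(_ isT) + /(_ isT) + /(_ isT) + /(_ isT) + /(_ isT) + /(_ isT); lia.
Qed.

Lemma well_wired_linear m n (d : diagram m n) : well_wired d -> linear_diagram d.
Proof.
move=> [s [us id od]]; rewrite /linear_diagram (perm_uniq id) (perm_uniq od).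
have IntI : injective (@Int m n) by move=> x y [].
by apply/andP; split; rewrite cat_uniq (map_inj_uniq IntI) us map_inj_uniq
  ?enum_uniq ?andbT /=; try (by move=> x y []);
  apply/hasPn => _ /mapP[k _ ->]; apply/mapP => -[].
Qed.

Lemma properadic_tractable m n (g : graph m n) : properadic_graph 3 g -> tractable g.
Proof.
move=> [sd wd ad _]; have [v [w vw]] := acyclic_currents ad.
by exists (energy v w (repr g)); split=> //; [exact: well_wired_linear|exists v, w].
Qed.

Lemma uniq_flatten_inj (T W : eqType) (f : T -> seq W) (d : seq T) i x y :
  uniq (flatten (map f d)) -> x \in d -> y \in d -> i \in f x -> i \in f y -> x = y.
Proof.
have sep (s : seq T) z : ~~ has (mem (f z)) (flatten (map f s)) -> i \in f z ->
    forall t, t \in s -> i \in f t -> False.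
  move=> /hasPn nz iz t ts it; have /nz : i \in flatten (map f s).
    by apply/flattenP; exists (f t) => //; exact: map_f.
  by rewrite /= iz.
elim: d => //= z d IHd; rewrite cat_uniq !inE => /and3P[_ zd ud].
case/predU1P => [->|xd]; case/predU1P => [->|yd] //.
- by move=> iz /(sep _ _ zd iz _ yd).
- by move=> ix iz; case: (sep _ _ zd iz _ xd ix).
- exact: IHd.
Qed.

(** * Overlaps of redexes *)

Section Overlaps.
Variables m n : nat.
Implicit Types (d o : diagram m n) (u v s : node (wire m n)).

(** The joining wire is the first output of [u] and the first input of [v], hence is determined by
    either end. *)
Lemma redex_wire u v : redex u v -> exists k,
  [/\ Int k \in outs u, Int k \in ins v,
     forall s, redex u s -> Int k \in ins s & forall s, redex s v -> Int k \in outs s].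
Proof.
case: u v => [x y [i|j|k]|x [i|j|k] y] [[i'|j'|k'] y' z'|[i'|j'|k'] y' z'] //= /eqP <-;
  exists k; split; rewrite ?inE ?eqxx ?orbT //.
all: by case=> [[i1|j1|k1] y1 [i2|j2|k2]|[i1|j1|k1] [i2|j2|k2] y1] //= /eqP->;
        rewrite !inE eqxx ?orbT.
Qed.

Lemma redex_asym (f g : wire m n -> nat) u v :
  currents f g u -> currents f g v -> redex u v -> ~~ redex v u.
Proof.
case: u v => [x y [i|j|k]|x [i|j|k] y] [[i'|j'|k'] y' z'|[i'|j'|k'] y' z'] //= cu cv /eqP kk.
- case: z' cv => [?|?|l] //=; case: x cu => [?|?|l'] //=; rewrite kk => cu cv.
  apply/eqP => E; move: cu cv; rewrite E; lia.
- by case: y' cv.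
- case: y' cv => [?|?|l] //=; case: x cu => [?|?|l'] //=; rewrite kk => cu cv.
  apply/eqP => E; move: cu cv; rewrite E; lia.
Qed.

(** Redexes with the same first vertex, or the same second vertex, share their joining wire and so
    coincide by linearity. Among three vertices, distinct redexes must therefore meet head to tail,
    and the currents exclude a two-cycle. *)
Lemma redex_overlap d u v o u' v' o' k : has_energy d k ->
  perm_eq d [:: u, v & o] -> perm_eq d [:: u', v' & o'] -> redex u v -> redex u' v' ->
  [\/ [/\ u' = u, v' = v & perm_eq o o'],
      [/\ u' = v, o = [:: v'] & o' = [:: u]] |
      [/\ v' = u, o = [:: u'] & o' = [:: v]]].
Proof.
move=> [sd /andP[li lo] [f [g [fg _]]]] du du' uv uv'.
have ud : uniq d by apply: linear_uniq; rewrite /linear_diagram li lo.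
have mem := perm_mem du; have mem' := perm_mem du'.
have [ind vnd] : u \in d /\ v \in d by rewrite !mem !inE !eqxx orbT.
have [u'd v'd] : u' \in d /\ v' \in d by rewrite !mem' !inE !eqxx orbT.
have [i [iu iv i_in i_out]] := redex_wire uv.
have same_u : u' = u -> v' = v.
  by move=> uu; apply: (uniq_flatten_inj li v'd vnd (i_in _ _) iv); rewrite -uu.
have same_v : v' = v -> u' = u.
  by move=> vv; apply: (uniq_flatten_inj lo u'd ind (i_out _ _) iu); rewrite -vv.
have asym : ~~ redex v u by apply: redex_asym uv; exact: (allP fg).
move: (perm_size du) (perm_size du'); rewrite sd /=.
case: o du mem => [|w [|? ?]] //= du mem _; case: o' du' mem' => [|w' [|? ?]] //= du' mem' _.
have up : uniq [:: u; v; w] by rewrite -(perm_uniq du).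
have up' : uniq [:: u'; v'; w'] by rewrite -(perm_uniq du').
have pp : perm_eq [:: u; v; w] [:: u'; v'; w'].
  by apply: perm_trans du'; rewrite perm_sym.
have [uu|nu] := eqVneq u' u.
  have vv := same_u uu; constructor 1; split=> //; move: pp; by rewrite uu vv !perm_cons.
have nv : v' != v by apply: contraNneq nu => /same_v->.
have : u' \in [:: u; v; w] by rewrite -mem.
have : v' \in [:: u; v; w] by rewrite -mem.
rewrite !inE (negbTE nu) (negbTE nv) /= => Ev Eu.
have last3 : w' \in [:: u; v; w] by rewrite -mem mem' !inE eqxx !orbT.
move: up' last3; rewrite /= !inE !negb_or andbT.
case/orP: Eu => /eqP Eu; case/orP: Ev => /eqP Ev; rewrite Eu Ev ?eqxx //=.
- by rewrite Eu Ev (negbTE asym) in uv'.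
- move=> /andP[/andP[_ vw'] ww'] /or3P[] /eqP E; rewrite E ?eqxx // in vw' ww' *.
  by constructor 2.
- move=> /andP[/andP[_ vw'] ww'] /or3P[] /eqP E; rewrite E ?eqxx // in vw' ww' *.
  by constructor 3.
Qed.

End Overlaps.

(** * Resolution of the critical pairs *)

Section CriticalPairs.
Variables (m n : nat) (K : fieldType).
Local Notation wire := (wire m n).
Local Notation diagram := (diagram m n).
Implicit Types (d e o : diagram) (u v : node wire) (w x y z s t : wire) (a : 4.-tuple K).

Definition contract_value a (f : diagram -> K) u v o : K :=
  \sum_(p <- contract a u v) p.1 * f (p.2 ++ o).

(** Because contraction recycles names, different reduction paths reach the same graph with its two
    internal wires exchanged. *)
Definition swap (k l i : nat) : nat := if i == k then l else if i == l then k else i.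

Lemma swapK k l : involutive (swap k l).
Proof.
move=> i; rewrite /swap; have [->|ik] := eqVneq i k.
  by rewrite eqxx; case: (eqVneq l k).
by have [->|il] := eqVneq i l; rewrite ?eqxx ?(negbTE ik) ?(negbTE il).
Qed.

Section SPolynomials.
Variables (a : 4.-tuple K) (f : diagram -> K).
Hypothesis f_perm : forall d e, perm_eq d e -> f d = f e.
Hypothesis f_rename : forall h d, bijective h -> f (rename_diagram h d) = f d.

Variables (x y z s t : wire) (k l : nat).
Local Notation k' := (Int k : wire).
Local Notation l' := (Int l : wire).

Let f_swap d e : perm_eq (rename_diagram (swap k l) d) e -> f d = f e.
Proof.
move=> /f_perm <-; rewrite f_rename //; exists (swap k l); exact: swapK.
Qed.

(* A row [(u, v, o)] is the diagram [u :: v :: o] with its redex [(u, v)]; the *)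
(* tables list the reductions resolving a critical pair.                      *)
Definition rows_assoc : seq (node wire * node wire * diagram) :=
  [:: (Mu x y k', Mu k' l' t, [:: Mu z s l']); (Mu x k' l', Mu l' s t, [:: Mu y z k']);
      (Mu y z k', Mu k' s l', [:: Mu x l' t])].

Definition rows_between : seq (node wire * node wire * diagram) :=
  [:: (Mu x y k', Delta k' s l', [:: Mu l' z t]);
      (Mu x y k', Mu k' l' s, [:: Delta z l' t]);
      (Mu x y k', Delta k' l' t, [:: Mu l' z s]);
      (Mu x y k', Mu k' l' t, [:: Delta z s l']);
      (Mu k' y l', Mu l' z t, [:: Delta x s k']);
      (Mu x k' l', Mu l' z t, [:: Delta y s k']);
      (Mu x k' l', Mu l' z s, [:: Delta y k' t]);
      (Mu k' y l', Mu l' z s, [:: Delta x k' t]);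
      (Mu x k' l', Delta l' s t, [:: Mu y z k']);
      (Mu y z k', Delta k' l' t, [:: Mu x l' s]);
      (Mu y z k', Delta k' s l', [:: Mu x l' t])].

(* Reading x, y, z as the inputs and s, t as the outputs: x_1 (x) x_2 (y z),   *)
(* x (y z_1) (x) z_2, x_1 (y z) (x) x_2, z_1 (x) x (y z_2), x_1 y (x) x_2 z,   *)
(* x_1 z (x) x_2 y, x z_1 (x) y z_2 and y z_1 (x) x z_2.                       *)
Definition normal_forms : seq diagram :=
  [:: [:: Mu y z l'; Mu k' l' t; Delta x s k']; [:: Mu y l' k'; Mu x k' s; Delta z l' t];
      [:: Mu y z l'; Mu k' l' s; Delta x k' t]; [:: Mu y l' k'; Mu x k' t; Delta z s l'];
      [:: Delta x k' l'; Mu k' y s; Mu l' z t]; [:: Delta x l' k'; Mu k' y t; Mu l' z s];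
      [:: Delta z l' k'; Mu y k' t; Mu x l' s]; [:: Delta z k' l'; Mu y k' s; Mu x l' t]].

Lemma all_rows (P : node wire * node wire * diagram -> Prop) rs :
  foldr (fun r => and (P r)) True rs -> forall r, r \in rs -> P r.
Proof. by elim: rs => //= r rs IHrs [Pr /IHrs Prs] q /predU1P[->|/Prs]. Qed.

Variable Q : diagram -> Prop.
Hypothesis Q_perm : forall d e, perm_eq d e -> Q d -> Q e.
Hypothesis Q_closed : forall u v o p,
  Q [:: u, v & o] -> redex u v -> p \in contract a u v -> Q (p.2 ++ o).

(** [Q] delimits the diagrams where [f] is known to respect reductions, later those of bounded rank;
    the rows are shown to stay inside it, starting from the two reducts. *)
Definition admissible r := redex r.1.1 r.1.2 /\ Q [:: r.1.1, r.1.2 & r.2].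

Let Q_nth u v o i : Q [:: u, v & o] -> redex u v -> (i < size (contract a u v))%N ->
  Q ((nth (0, [::]) (contract a u v) i).2 ++ o).
Proof. by move=> Qu uv iu; apply: Q_closed Qu uv _; exact: mem_nth. Qed.

Local Ltac permute H := by apply: Q_perm H; apply/permP => b /=; lia.

Lemma rows_assoc_admissible :
  (forall p, p \in contract a (Mu k' z l') (Mu l' s t) -> Q (p.2 ++ [:: Mu x y k'])) ->
  (forall p, p \in contract a (Mu x y k') (Mu k' z l') -> Q (p.2 ++ [:: Mu l' s t])) ->
  forall r, r \in rows_assoc -> admissible r.
Proof.
move=> QA QB.
have A0 := QA _ (mem_head _ _); have B0 := QB _ (mem_head _ _).
have Q0 : Q [:: Mu x y k'; Mu k' l' t; Mu z s l'] by permute A0.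
have Q1 : Q [:: Mu x k' l'; Mu l' s t; Mu y z k'] by permute B0.
have C1 := @Q_nth _ _ _ 0 Q1 (eqxx l) isT.
have Q2 : Q [:: Mu y z k'; Mu k' s l'; Mu x l' t] by permute C1.
by apply: all_rows; rewrite /admissible /= !eqxx.
Qed.

Lemma rows_between_admissible :
  (forall p, p \in contract a (Mu k' z l') (Delta l' s t) -> Q (p.2 ++ [:: Mu x y k'])) ->
  (forall p, p \in contract a (Mu x y k') (Mu k' z l') -> Q (p.2 ++ [:: Delta l' s t])) ->
  forall r, r \in rows_between -> admissible r.
Proof.
move=> QA QB.
have A i : (i < size (contract a (Mu k' z l') (Delta l' s t)))%N ->
    Q ((nth (0, [::]) (contract a (Mu k' z l') (Delta l' s t)) i).2 ++ [:: Mu x y k']).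
  by move=> i4; apply/QA/mem_nth.
have A0 := A 0 isT; have A1 := A 1 isT; have A2 := A 2 isT; have A3 := A 3 isT.
have B0 := QB _ (mem_head _ _).
have Q0 : Q [:: Mu x y k'; Delta k' s l'; Mu l' z t] by permute A0.
have Q1 : Q [:: Mu x y k'; Mu k' l' s; Delta z l' t] by permute A1.
have Q2 : Q [:: Mu x y k'; Delta k' l' t; Mu l' z s] by permute A2.
have Q3 : Q [:: Mu x y k'; Mu k' l' t; Delta z s l'] by permute A3.
have Q8 : Q [:: Mu x k' l'; Delta l' s t; Mu y z k'] by permute B0.
have C4 := @Q_nth _ _ _ 0 Q0 (eqxx k) isT.
have Q4 : Q [:: Mu k' y l'; Mu l' z t; Delta x s k'] by permute C4.
have C5 := @Q_nth _ _ _ 3 Q0 (eqxx k) isT.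
have Q5 : Q [:: Mu x k' l'; Mu l' z t; Delta y s k'] by permute C5.
have C6 := @Q_nth _ _ _ 1 Q2 (eqxx k) isT.
have Q6 : Q [:: Mu x k' l'; Mu l' z s; Delta y k' t] by permute C6.
have C7 := @Q_nth _ _ _ 2 Q2 (eqxx k) isT.
have Q7 : Q [:: Mu k' y l'; Mu l' z s; Delta x k' t] by permute C7.
have C9 := @Q_nth _ _ _ 1 Q8 (eqxx l) isT.
have Q9 : Q [:: Mu y z k'; Delta k' l' t; Mu x l' s] by permute C9.
have C10 := @Q_nth _ _ _ 3 Q8 (eqxx l) isT.
have Q10 : Q [:: Mu y z k'; Delta k' s l'; Mu x l' t] by permute C10.
by apply: all_rows; rewrite /admissible /= !eqxx; do !split.
Qed.

Hypothesis fresh : all (fun w => (w != k') && (w != l')) [:: x; y; z; s; t].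

Let swap_fix : [/\ rename (swap k l) x = x, rename (swap k l) y = y,
  rename (swap k l) z = z, rename (swap k l) s = s & rename (swap k l) t = t].
Proof.
have E w : (w != k') && (w != l') -> rename (swap k l) w = w.
  case: w => //= i /andP[ik il]; rewrite /swap.
  have [ei|_] := eqVneq i k; first by rewrite ei eqxx in ik.
  by have [ei|_] := eqVneq i l; first by rewrite ei eqxx in il.
by move: fresh => /= /and5P[? ? ? ? /andP[? _]]; split; exact: E.
Qed.

Let swap_k : swap k l k = l. Proof. by rewrite /swap eqxx. Qed.
Let swap_l : swap k l l = k. Proof. by rewrite /swap eqxx; case: (eqVneq l k). Qed.

Definition value r := f [:: r.1.1, r.1.2 & r.2] = contract_value a f r.1.1 r.1.2 r.2.

Local Ltac same :=
  first [ by apply: f_perm; apply/permP => b /=; lia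
        | apply: f_swap; rewrite /= ?swap_k ?swap_l;
          have [-> -> -> -> ->] := swap_fix; by apply/permP => b /=; lia ].

Lemma spoly_assoc : (forall r, r \in rows_assoc -> value r) ->
  contract_value a f (Mu k' z l') (Mu l' s t) [:: Mu x y k'] =
  contract_value a f (Mu x y k') (Mu k' z l') [:: Mu l' s t].
Proof.
move=> rowsE.
have R i : (i < size rows_assoc)%N -> value (nth (Mu x x x, Mu x x x, [::]) rows_assoc i).
  by move=> ltir; apply/rowsE/mem_nth.
have R1 := R 0 isT.
have R2 := R 1 isT.
have R3 := R 2 isT.
rewrite /value /contract_value /= !big_cons !big_nil /= in R1 R2 R3 *.
rewrite !mul1r !addr0 in R1 R2 R3 *.
have -> : f [:: Mu z s l'; Mu k' l' t; Mu x y k'] = f [:: Mu x y k'; Mu k' l' t; Mu z s l'] by same.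
have -> : f [:: Mu y z k'; Mu x k' l'; Mu l' s t] = f [:: Mu x k' l'; Mu l' s t; Mu y z k'] by same.
rewrite R1 // R2 //.
have -> : f [:: Mu k' s l'; Mu x l' t; Mu y z k'] = f [:: Mu y z k'; Mu k' s l'; Mu x l' t] by same.
by rewrite R3 //; same.
Qed.

Let N i := f (nth [::] normal_forms i).

(** The rows expand both reducts into irreducible diagrams. The terms with mixed coefficients such
    as a_1 a_2 match and cancel, leaving those that occur once linearly and once quadratically, and
    the products a_1 a_3 and a_2 a_4. *)
Lemma spoly_between : (forall r, r \in rows_between -> value r) ->
  contract_value a f (Mu k' z l') (Delta l' s t) [:: Mu x y k'] -
  contract_value a f (Mu x y k') (Mu k' z l') [:: Delta l' s t] =
  (a`_0 ^+ 2 - a`_0) * N 0 - (a`_1 ^+ 2 - a`_1) * N 1 + (a`_2 ^+ 2 - a`_2) * N 2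
  - (a`_3 ^+ 2 - a`_3) * N 3 + a`_0 * a`_2 * (N 4 + N 5) - a`_1 * a`_3 * (N 6 + N 7).
Proof.
move=> rowsE.
have R i : (i < size rows_between)%N -> value (nth (Mu x x x, Mu x x x, [::]) rows_between i).
  by move=> ltir; apply/rowsE/mem_nth.
have R0 := R 0 isT.
have R1 := R 1 isT.
have R2 := R 2 isT.
have R3 := R 3 isT.
have R4 := R 4 isT.
have R5 := R 5 isT.
have R6 := R 6 isT.
have R7 := R 7 isT.
have R8 := R 8 isT.
have R9 := R 9 isT.
have R10 := R 10 isT.
rewrite /value /contract_value /= !big_cons !big_nil /= in R0 R1 R2 R3 R4 R5 R6 R7 R8 R9 R10 *.
rewrite ?mul1r !addr0 in R0 R1 R2 R3 R4 R5 R6 R7 R8 R9 R10 *.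
have -> : f [:: Delta k' s l'; Mu l' z t; Mu x y k'] =
  f [:: Mu x y k'; Delta k' s l'; Mu l' z t] by same.
have -> : f [:: Delta z l' t; Mu k' l' s; Mu x y k'] =
  f [:: Mu x y k'; Mu k' l' s; Delta z l' t] by same.
have -> : f [:: Delta k' l' t; Mu l' z s; Mu x y k'] =
  f [:: Mu x y k'; Delta k' l' t; Mu l' z s] by same.
have -> : f [:: Delta z s l'; Mu k' l' t; Mu x y k'] =
  f [:: Mu x y k'; Mu k' l' t; Delta z s l'] by same.
have -> : f [:: Mu y z k'; Mu x k' l'; Delta l' s t] =
  f [:: Mu x k' l'; Delta l' s t; Mu y z k'] by same.
rewrite R0 // R1 // R2 // R3 // R8 //.
have -> : f [:: Delta x s k'; Mu k' y l'; Mu l' z t] =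
  f [:: Mu k' y l'; Mu l' z t; Delta x s k'] by same.
have -> : f [:: Delta y s k'; Mu x k' l'; Mu l' z t] =
  f [:: Mu x k' l'; Mu l' z t; Delta y s k'] by same.
have -> : f [:: Delta y k' t; Mu x k' l'; Mu l' z s] =
  f [:: Mu x k' l'; Mu l' z s; Delta y k' t] by same.
have -> : f [:: Delta x k' t; Mu k' y l'; Mu l' z s] =
  f [:: Mu k' y l'; Mu l' z s; Delta x k' t] by same.
have -> : f [:: Delta k' l' t; Mu x l' s; Mu y z k'] =
  f [:: Mu y z k'; Delta k' l' t; Mu x l' s] by same.
have -> : f [:: Delta k' s l'; Mu x l' t; Mu y z k'] =
  f [:: Mu y z k'; Delta k' s l'; Mu x l' t] by same.
rewrite R4 // R5 // R6 // R7 // R9 // R10 //.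
have -> : f [:: Delta x s l'; Mu l' k' t; Mu y z k'] =
  f [:: Mu y z l'; Mu k' l' t; Delta x s k'] by same.
have -> : f [:: Delta x l' t; Mu l' k' s; Mu y z k'] =
  f [:: Mu y z l'; Mu k' l' s; Delta x k' t] by same.
have -> : f [:: Delta y l' k'; Mu k' z t; Mu x l' s] =
  f [:: Delta y k' l'; Mu x k' s; Mu l' z t] by same.
have -> : f [:: Delta z k' t; Mu y k' l'; Mu x l' s] =
  f [:: Mu y l' k'; Mu x k' s; Delta z l' t] by same.
have -> : f [:: Delta y k' t; Mu k' z l'; Mu x l' s] =
  f [:: Mu k' z l'; Mu x l' s; Delta y k' t] by same.
have -> : f [:: Delta y s k'; Mu k' z l'; Mu x l' t] =
  f [:: Mu k' z l'; Mu x l' t; Delta y s k'] by same.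
have -> : f [:: Delta y k' l'; Mu k' z s; Mu x l' t] =
  f [:: Delta y l' k'; Mu x k' t; Mu l' z s] by same.
have -> : f [:: Delta z s k'; Mu y k' l'; Mu x l' t] =
  f [:: Mu y l' k'; Mu x k' t; Delta z s l'] by same.
rewrite /N /=; ring.
Qed.

End SPolynomials.
End CriticalPairs.

(** * Chains of redexes and reversal of the arrows *)

Section Chains.
Variables (m n : nat) (K : fieldType).
Local Notation wire := (wire m n).
Local Notation diagram := (diagram m n).
Implicit Types (d e o : diagram) (u v w : node wire) (x y z s t : wire) (a : 4.-tuple K).

Definition contraction_closed a (Q : diagram -> Prop) : Prop :=
  (forall d e, perm_eq d e -> Q d -> Q e) /\
  (forall u v o p, Q [:: u, v & o] -> redex u v -> p \in contract a u v -> Q (p.2 ++ o)).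

Definition system a (f : diagram -> K) (Q : diagram -> Prop) : Prop :=
  [/\ forall d e, perm_eq d e -> f d = f e,
      forall h d, bijective h -> f (rename_diagram h d) = f d,
      contraction_closed a Q &
      forall u v o, Q [:: u, v & o] -> redex u v -> f [:: u, v & o] = contract_value a f u v o].

(** The two internal names already occur as an input and as an output, so linearity leaves no room
    for an outer wire to bear them. *)
Lemma linear_fresh u v w x y z s t k l :
  linear_diagram [:: u; v; w] ->
  perm_eq (flatten (map (@ins _) [:: u; v; w]) ++ flatten (map (@outs _) [:: u; v; w]))
    [:: x; y; z; s; t; Int k; Int k; Int l; Int l] ->
  all (fun i => (i != Int k) && (i != Int l)) [:: x; y; z; s; t].
Proof.
move=> luvw /permP uvw.
have nI j : (2 <= count_mem (Int j : wire) [:: Int k; Int k; Int l; Int l])%N ->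
    Int j \notin [:: x; y; z; s; t].
  rewrite -has_pred1 has_count => j2.
  have := uvw (pred1 (Int j)); have [] := linear_count (Int j) luvw.
  rewrite (count_cat _ (flatten _)) (count_cat _ [:: x; y; z; s; t] [:: _; _; _; _]).
  move=> ci co E; have := leq_add ci co; rewrite {}E {ci co}; move: j2.
  by move: (count_mem _ _) (count_mem _ _) => p q; lia.
apply/allP => i i5; apply/andP; split; apply/eqP => E.
  by have := nI k; rewrite /= !eqxx -E i5 => /(_ isT).
by have := nI l; rewrite -E i5 E /= !eqxx; case: (_ == _) => /(_ isT).
Qed.

Lemma in_C_nth a i : in_C a -> (i < 4)%N -> a`_i ^+ 2 = a`_i.
Proof. by move=> [aa _] i4; have := aa (Ordinal i4); rewrite (tnth_nth 0). Qed.

(** The vertex before a product in a redex is a product, so only the product or coproduct of a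
    triple product can occur. *)
Lemma mul_chain a f Q u x y z w : system a f Q -> in_C a ->
  linear_diagram [:: u; Mu x y z; w] -> redex u (Mu x y z) -> redex (Mu x y z) w ->
  (forall p, p \in contract a u (Mu x y z) -> Q (p.2 ++ [:: w])) ->
  (forall p, p \in contract a (Mu x y z) w -> Q (p.2 ++ [:: u])) ->
  contract_value a f u (Mu x y z) [:: w] = contract_value a f (Mu x y z) w [:: u].
Proof.
move=> [f_perm f_rename [Q_perm Q_closed] fQ] aC luvw.
case: u x z luvw => [x1 y1 [i|j|k]|x1 [i|j|k] y1] [i'|j'|k'] [i2|j2|l] //= luvw /eqP kk';
  rewrite -{k'}kk' in luvw *.
case: w luvw => [[i3|j3|l'] s t|[i3|j3|l'] s t] luvw //= /eqP ll' Qu Qw; rewrite -{l'}ll' in luvw Qu Qw *.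
- apply/esym/spoly_assoc => //.
    apply: linear_fresh luvw _; apply/permP => b /=; lia.
  move=> r /(rows_assoc_admissible Q_perm Q_closed Qw Qu)[rr Qr]; exact: fQ.
- apply/esym/eqP; rewrite -subr_eq0 spoly_between //; last 1 first.
  + move=> r /(rows_between_admissible Q_perm Q_closed Qw Qu)[rr Qr]; exact: fQ.
  + rewrite !in_C_nth // !subrr; case: aC => _ [-> ->].
    by rewrite !mul0r !(subr0, addr0).
  + apply: linear_fresh luvw _; apply/permP => b /=; lia.
Qed.

(* Turning a diagram upside down, without exchanging the names of its inputs  *)
(* and outputs.                                                               *)
Definition flip u : node wire :=
  match u with Mu x y z => Delta z x y | Delta x y z => Mu y z x end.

Lemma flipK : involutive flip. Proof. by case. Qed.

Lemma flip_redex u v : redex (flip v) (flip u) = redex u v.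
Proof.
case: u v => [x y [i|j|k]|[i|j|k] [i1|j1|k1] y] [[i'|j'|k'] y' [i2|j2|k2]|[i'|j'|k'] [i2|j2|k2] z'] //=;
by rewrite eq_sym.
Qed.

Lemma flip_linear d : linear_diagram (map flip d) = linear_diagram d.
Proof.
have ins_flip : map (@ins _) (map flip d) = map (@outs _) d.
  by rewrite -map_comp; apply: eq_map => -[].
have outs_flip : map (@outs _) (map flip d) = map (@ins _) d.
  by rewrite -map_comp; apply: eq_map => -[].
by rewrite /linear_diagram ins_flip outs_flip andbC.
Qed.

(** Reversal exchanges the two associativity rules and permutes the four terms of the mixed rule,
    swapping the first two. *)
Lemma flip_contract a u v : redex u v ->
  perm_eq (contract a (flip v) (flip u))
    (map (fun p => (p.1, rev (map flip p.2))) (contract (tilde a) u v)).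
Proof.
move=> uv; case: (redexP (tilde a) uv) => x y z t k; try exact: perm_refl.
apply/permP => b; rewrite /rev /tilde /=; lia.
Qed.

Lemma flip_contract_value a f u v o : (forall d e, perm_eq d e -> f d = f e) ->
  redex u v ->
  contract_value (tilde a) (f \o map flip) u v o = contract_value a f (flip v) (flip u) (map flip o).
Proof.
move=> f_perm uv; rewrite /contract_value (perm_big _ (flip_contract a uv)) big_map.
apply: eq_bigr => p _ /=; congr (_ * _); apply: f_perm.
by rewrite map_cat perm_cat2r perm_sym perm_rev.
Qed.

Lemma flip_closed a Q : contraction_closed a Q -> contraction_closed (tilde a) (Q \o map flip).
Proof.
move=> [Q_perm Q_closed]; split.
  by move=> d e de /=; apply: Q_perm; exact: perm_map.
move=> u v o p /= Qo uv pc.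
have [q qc pq] : exists2 q, q \in contract a (flip v) (flip u) & perm_eq q.2 (map flip p.2).
  exists (p.1, rev (map flip p.2)); last by rewrite /= perm_rev.
  by rewrite (perm_mem (flip_contract a uv)); apply/mapP; exists p.
have {}Qo : Q [:: flip v, flip u & map flip o].
  by apply: Q_perm Qo; apply/permP => b /=; lia.
apply: Q_perm (Q_closed _ _ _ _ Qo _ qc); last by rewrite flip_redex.
by rewrite map_cat perm_cat2r.
Qed.

Lemma flip_rename h d : rename_diagram h (map flip d) = map flip (rename_diagram h d).
Proof. by rewrite /rename_diagram -!map_comp; apply: eq_map => -[]. Qed.

Lemma flip_system a f Q : system a f Q -> system (tilde a) (f \o map flip) (Q \o map flip).
Proof.
move=> [f_perm f_rename Qc fQ]; split; last 1 first.
- move=> u v o /= Qo uv; rewrite flip_contract_value // -fQ ?flip_redex //.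
    by apply: f_perm; apply/permP => b /=; lia.
  by apply: (proj1 Qc) Qo; apply/permP => b /=; lia.
- by move=> d e de; apply: f_perm; exact: perm_map.
- by move=> h d bh /=; rewrite -flip_rename f_rename.
- exact: flip_closed.
Qed.

(** If the middle vertex is a coproduct, the reversed chain has a product in the middle and
    [tilde a] as parameters. *)
Lemma chain_confluent a f Q u v w : system a f Q -> in_C a -> in_C (tilde a) ->
  linear_diagram [:: u; v; w] -> redex u v -> redex v w ->
  (forall p, p \in contract a u v -> Q (p.2 ++ [:: w])) ->
  (forall p, p \in contract a v w -> Q (p.2 ++ [:: u])) ->
  contract_value a f u v [:: w] = contract_value a f v w [:: u].
Proof.
case: v => x y z sys aC aC' luvw uv vw Qu Qw; first exact: mul_chain sys aC _ _ _ _ _.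
have [f_perm _ [Q_perm _] _] := sys.
set v := Delta x y z in luvw uv vw Qu Qw *.
have flip_value u1 v1 w1 : redex u1 v1 -> contract_value a f u1 v1 [:: w1] =
    contract_value (tilde a) (f \o map flip) (flip v1) (flip u1) [:: flip w1].
  by move=> uv1; rewrite flip_contract_value ?flip_redex //= !flipK.
have flip_Q u1 v1 w1 : redex u1 v1 -> (forall p, p \in contract a u1 v1 -> Q (p.2 ++ [:: w1])) ->
    forall p, p \in contract (tilde a) (flip v1) (flip u1) -> (Q \o map flip) (p.2 ++ [:: flip w1]).
  move=> uv1 Q1 p pc; have uv1' : redex (flip v1) (flip u1) by rewrite flip_redex.
  have pc' : (p.1, rev (map flip p.2)) \in contract a u1 v1.
    rewrite -[u1]flipK -[v1]flipK (perm_mem (flip_contract a uv1')).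
    by apply/mapP; exists p.
  apply: Q_perm (Q1 _ pc'); rewrite map_cat /= flipK perm_cat2r perm_rev //.
rewrite !flip_value //; apply/esym; apply: (mul_chain (flip_system sys)) => //.
- rewrite (_ : [:: _; _; _] = map flip [:: w; v; u]) // flip_linear.
  by rewrite -(linear_perm (d := [:: u; v; w])) //; apply/permP => b /=; lia.
- by rewrite -(flip_redex v w) in vw.
- by rewrite -(flip_redex u v) in uv.
- exact: flip_Q vw Qw.
- exact: flip_Q uv Qu.
Qed.

End Chains.

(** * Sufficiency: local confluence for graphs *)

Section Properads.
Variables (m n : nat) (K : fieldType) (a : 4.-tuple K).
Implicit Types (d o : diagram m n) (u v : node (wire m n)) (g h : graph m n).

Lemma fglift_contraction (f : graph m n -> K^o) u v o :
  fglift f (contraction a u v o) = contract_value a (fun d => f (graph_of d)) u v o.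
Proof.
by rewrite /contraction fglift_sum; apply: eq_bigr => p _; rewrite fgliftZ fglift1.
Qed.

Lemma contraction_perm u v o o' : perm_eq o o' -> contraction a u v o = contraction a u v o'.
Proof.
move=> oo'; apply: eq_bigr => p _; rewrite (graph_of_perm (e := p.2 ++ o')) //.
by rewrite perm_cat2l.
Qed.

Lemma coeff_contraction u v o h : coeff h (contraction a u v o) != 0 ->
  exists2 p, p \in contract a u v & h = graph_of (p.2 ++ o).
Proof.
move=> nz; apply: contrapT => np; case/eqP: nz.
rewrite coeff_sum big_seq big1 // => p pc; rewrite coeffZ coeff1.
by case: eqP => [ph|]; rewrite ?mulr0 //; case: np; exists p.
Qed.

Lemma tractable_linear d : tractable (graph_of d) -> linear_diagram d.
Proof. by move=> [k /has_energy_repr[]]. Qed.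

Lemma reduces_graph g r : reduces a g r -> exists u v o,
  [/\ g = graph_of [:: u, v & o], redex u v & r = contraction a u v o].
Proof.
move=> /(reduces_inv (d := repr g))[|u [v [o [du uv ->]]]]; first exact: reprK.
exists u, v, o; split=> //; rewrite -(graph_of_perm du); exact/esym/reprK.
Qed.

Lemma reduces_decr g r h : tractable g -> reduces a g r -> coeff h r != 0 ->
  tractable h /\ (rank h < rank g)%N.
Proof.
move=> tg /reduces_graph[u [v [o [gE uv ->]]]] /coeff_contraction[p pc ->].
by rewrite gE in tg *; exact: rank_decr tg uv pc.
Qed.

Lemma tractable_closed N : contraction_closed a
  (fun d => tractable (graph_of d) /\ (rank (graph_of d) < N)%N).
Proof.
split=> [d e de|u v o p [td dN] uv pc]; first by rewrite (graph_of_perm de).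
have [tp pd] := rank_decr td uv pc.
by split=> //; exact: ltn_trans dN.
Qed.

Lemma graph_system (f : graph m n -> K^o) N :
  (forall g s, tractable g -> (rank g < N)%N -> reduces a g s -> f g = fglift f s) ->
  system a (fun d => f (graph_of d))
    (fun d => tractable (graph_of d) /\ (rank (graph_of d) < N)%N).
Proof.
move=> fE; split; last 2 first.
- exact: tractable_closed.
- move=> u v o [td dN] uv; rewrite -fglift_contraction; apply: fE => //.
  by apply: reduces_intro => //; exact: tractable_linear.
- by move=> d e de; rewrite (graph_of_perm de).
- by move=> h d bh; rewrite graph_of_rename //; exact: bij_inj.
Qed.

Lemma chain_contraction (f : graph m n -> K^o) u v w : in_C a -> in_C (tilde a) ->
  tractable (graph_of [:: u; v; w]) -> redex u v -> redex v w ->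
  (forall g s, tractable g -> (rank g < rank (graph_of [:: u; v; w]))%N ->
     reduces a g s -> f g = fglift f s) ->
  fglift f (contraction a u v [:: w]) = fglift f (contraction a v w [:: u]).
Proof.
move=> aC aC' tg uv vw fE; rewrite !fglift_contraction.
apply: (chain_confluent (graph_system fE)) => //; first exact: tractable_linear.
  by move=> p pc; exact: rank_decr tg uv pc.
have vwu : graph_of [:: u; v; w] = graph_of [:: v; w; u].
  by apply: graph_of_perm; apply/permP => b /=; lia.
by rewrite vwu in tg *; move=> p pc; exact: rank_decr tg vw pc.
Qed.

Lemma reduces_locally_confluent : in_C a -> in_C (tilde a) ->
  forall g r r', tractable g -> reduces a g r -> reduces a g r' ->
  forall f : graph m n -> K^o,
    (forall g' s, tractable g' -> (rank g' < rank g)%N -> reduces a g' s ->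
       f g' = fglift f s) ->
  fglift f r = fglift f r'.
Proof.
move=> aC aC' g r r' tg gr gr' f fE; have [k gk] := tg.
have [u [v [o [du uv ->]]]] := reduces_inv gr (reprK g).
have [u' [v' [o' [du' uv' ->]]]] := reduces_inv gr' (reprK g).
have gE : graph_of (repr g) = g by exact: reprK.
case: (redex_overlap gk du du' uv uv').
- by move=> [-> -> oo']; rewrite (contraction_perm _ _ oo').
- move=> [uE oE oE']; subst u' o o'.
  have gE' : g = graph_of [:: u; v; v'] by rewrite -gE; exact: graph_of_perm.
  by rewrite gE' in fE tg; exact: chain_contraction.
- move=> [vE oE oE']; subst v' o o'; apply/esym.
  have gE' : g = graph_of [:: u'; u; v] by rewrite -gE; exact: graph_of_perm.
  by rewrite gE' in fE tg; exact: chain_contraction.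
Qed.

Lemma strategy_exists : exists phi : graph m n -> lincomb K m n, forall g,
  reduces a g (phi g) \/ phi g = << g >> /\ irreducible (@reduces K a m n) g.
Proof.
have /boolp.choice[phi phiP] : forall g, exists r,
    reduces a g r \/ r = << g >> /\ irreducible (@reduces K a m n) g.
  move=> g; case: (pselect (exists r, reduces a g r)) => [[r gr]|ng].
    by exists r; left.
  by exists << g >>; right; split=> // r gr; case: ng; exists r.
by exists phi.
Qed.

End Properads.

Lemma in_C_confluent (K : fieldType) (a : 4.-tuple K) :
  in_C a -> in_C (tilde a) -> induces_confluent a.
Proof.
move=> aC aC' m n x b c px; have [phi phiP] := strategy_exists m n a.
apply: (locally_confluentP (@reduces_decr m n K a) phiP
         (reduces_locally_confluent aC aC')).
by move=> g /px; exact: properadic_tractable.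
Qed.

(** * Decidable criteria for irreducibility, distinctness and unique reducts *)

Section Shape.
Variables m n : nat.
Implicit Types (d e o : diagram m n) (u v s : node (wire m n)).

(** Up to order, the result is an invariant of the isomorphism class, so graphs can be told apart by
    computation instead of a search over renamings. *)
Definition erase d : diagram m n := rename_diagram (fun _ => 0%N) d.

Lemma graph_of_erase d e : graph_of d = graph_of e -> perm_eq (erase d) (erase e).
Proof.
move=> /graph_ofP/asboolP[f [_ de]]; rewrite perm_sym.
rewrite -(perm_sym (erase d)); apply: perm_trans (perm_map _ de).
by rewrite (map_nodeE (h := rename (fun _ => 0%N))) //; case.
Qed.

Definition reducible d := has (fun u => has (redex u) d) d.
Definition has_chain d := has (fun u => has (fun v => redex u v && has (redex v) d) d) d.

Lemma has_chainT d u v s : u \in d -> v \in d -> s \in d ->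
  redex u v -> redex v s -> has_chain d.
Proof.
move=> ud vd sd uv vs; apply/hasP; exists u => //; apply/hasP; exists v => //.
by rewrite uv; apply/hasP; exists s.
Qed.

Variables (K : fieldType) (a : 4.-tuple K).

Lemma irreducible_graph d : ~~ reducible d -> irreducible (@reduces K a m n) (graph_of d).
Proof.
move=> /negP nd r /reduces_inv/(_ (erefl _))[u [v [o [du uv _]]]]; apply: nd.
apply/hasP; exists u; first by rewrite (perm_mem du) !inE eqxx.
by apply/hasP; exists v => //; rewrite (perm_mem du) !inE eqxx orbT.
Qed.

(** By [redex_overlap] a second redex would form a chain with the first. *)
Lemma unique_reduct u v o r : tractable (graph_of [:: u, v & o]) -> redex u v ->
  ~~ has_chain [:: u, v & o] -> reduces a (graph_of [:: u, v & o]) r ->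
  r = contraction a u v o.
Proof.
move=> [k /has_energy_repr dk] uv nc /reduces_inv/(_ (erefl _))[u' [v' [o' [du uv' ->]]]].
have mem := perm_mem du.
case: (redex_overlap dk (perm_refl _) du uv uv').
- by move=> [-> -> oo']; apply: contraction_perm; rewrite perm_sym.
- move=> [uE _ _]; case/negP: nc; apply: (has_chainT _ _ _ uv (s := v')).
  + by rewrite !inE eqxx.
  + by rewrite !inE eqxx orbT.
  + by rewrite mem !inE eqxx orbT.
  + by rewrite -uE.
- move=> [vE _ _]; case/negP: nc; apply: (has_chainT _ _ _ uv' (s := v)).
  + by rewrite mem !inE eqxx.
  + by rewrite mem !inE eqxx orbT.
  + by rewrite !inE eqxx orbT.
  + by rewrite vE.
Qed.

End Shape.

(** * Necessity: reading the equations off the normal forms *)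

Section Necessity.
Variables (m n : nat) (K : fieldType) (a : 4.-tuple K) (b : bool).
Local Notation wire := (wire m n).
Local Notation diagram := (diagram m n).
Implicit Types (d e o : diagram) (u v : node wire).

Let a' := if b then tilde a else a.

(** The flag [b] treats both orientations at once: the chain itself yields conditions on [a], its
    reversal conditions on [tilde a]. *)
Definition upturn d : diagram := if b then map (@flip m n) d else d.

Let head_of u v : node wire := if b then flip v else u.
Let next_of u v : node wire := if b then flip u else v.

Let upturn_perm d e : perm_eq d e -> perm_eq (upturn d) (upturn e).
Proof. by rewrite /upturn; case: b => // /(perm_map (@flip m n)). Qed.

Let upturn_rename h d : rename_diagram h (upturn d) = upturn (rename_diagram h d).
Proof. by rewrite /upturn; case: b => //; exact: flip_rename. Qed.

Let upturn_redex u v : redex u v -> redex (head_of u v) (next_of u v).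
Proof. by rewrite /head_of /next_of; case: b => //; rewrite flip_redex. Qed.

Let upturn_cons u v o :
  perm_eq (upturn [:: u, v & o]) [:: head_of u v, next_of u v & upturn o].
Proof.
rewrite /upturn /head_of /next_of; case: b => //=; apply/permP => p /=; lia.
Qed.

Let upturn_value f u v o : (forall d e, perm_eq d e -> f d = f e) -> redex u v ->
  contract_value a' (f \o upturn) u v o =
  contract_value a f (head_of u v) (next_of u v) (upturn o).
Proof.
rewrite /a' /upturn /head_of /next_of /comp; case: b => // f_perm uv.
exact: flip_contract_value.
Qed.

Let upturn_closed Q : contraction_closed a Q -> contraction_closed a' (Q \o upturn).
Proof. by rewrite /a' /upturn; case: b => //; exact: flip_closed. Qed.

Variables x y z s t : wire.
Let u : node wire := Mu x y (Int 0).
Let v : node wire := Mu (Int 0) z (Int 1).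
Let w : node wire := Delta (Int 1) s t.
Let g : graph m n := graph_of (upturn [:: u; v; w]).
Let rows := rows_between x y z s t 0 1.
Let nfs := normal_forms x y z s t 0 1.

Lemma confluent_in_C_upturn :
  all (fun i : wire => (i != Int 0) && (i != Int 1)) [:: x; y; z; s; t] ->
  all (fun r => ~~ has_chain (upturn [:: r.1.1, r.1.2 & r.2])) rows ->
  all (fun d => ~~ reducible (upturn d)) nfs ->
  pairwise (fun d e => ~~ perm_eq (erase (upturn d)) (erase (upturn e))) nfs ->
  tractable g ->
  (forall c c', clos_refl_trans _ (@step K a m n) << g >> c ->
     clos_refl_trans _ (@step K a m n) << g >> c' ->
     exists q, clos_refl_trans _ (@step K a m n) c q /\
               clos_refl_trans _ (@step K a m n) c' q) ->
  in_C a'.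
Proof.
move=> fresh nochain irr distinct tg conf.
have [phi phiP] := strategy_exists m n a.
(* The successor puts [g] itself, and not only its reducts, below the bound. *)
pose N := (rank g).+1.
pose f h : graph m n -> K^o := normal_coeff phi N h.
pose Q d := tractable (graph_of d) /\ (rank (graph_of d) < N)%N.
have [Q_perm Q_closed] : contraction_closed a' (Q \o upturn).
  exact/upturn_closed/tractable_closed.
have uv : redex u v by exact: eqxx.
have vw : redex v w by exact: eqxx.
have Quvw : (Q \o upturn) [:: u; v; w] by split.
have Qvwu : (Q \o upturn) [:: v; w; u].
  by apply: Q_perm Quvw; apply/permP => p /=; lia.
have adm r : r \in rows -> admissible (Q \o upturn) r.
  apply: (rows_between_admissible Q_perm Q_closed) => p pc.
    exact: Q_closed Qvwu vw pc.
  exact: Q_closed Quvw uv pc.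
have f_perm h d e : perm_eq d e -> f h (graph_of d) = f h (graph_of e).
  by move=> /graph_of_perm->.
have rowE h r : r \in rows -> value a' ((fun d => f h (graph_of d)) \o upturn) r.
  move=> rr; have [rd [tr Nr]] := adm r rr; have nc := allP nochain r rr.
  case: r {rr} rd tr Nr nc => [[p q] o] /= rd tr Nr nc.
  rewrite /value /= upturn_value //; last exact: f_perm.
  have pqo := upturn_cons p q o; have rd' := upturn_redex rd.
  rewrite (graph_of_perm pqo) in tr Nr *.
  have nc' : ~~ has_chain [:: head_of p q, next_of p q & upturn o].
    apply: contra nc => /hasP[i id /hasP[j jd /andP[ij /hasP[l ld jl]]]].
    by apply: (has_chainT _ _ _ ij jl); rewrite (perm_mem pqo).
  rewrite -fglift_contraction /f -coeff_normalize.
  have red := reduces_intro a (tractable_linear tr) rd'.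
  rewrite /normal_coeff (normalize_red (@reduces_decr m n K a) phiP (r := contraction a (head_of p q) (next_of p q) (upturn o))) //.
    by right.
  case: (phiP (graph_of [:: head_of p q, next_of p q & upturn o])) => [|[_ /(_ _ red)//]].
  exact: unique_reduct.
(* Confluence is used only here, at the peak formed by the two redexes of the initial chain. *)
have top h : contract_value a' ((fun d => f h (graph_of d)) \o upturn) v w [:: u] =
    contract_value a' ((fun d => f h (graph_of d)) \o upturn) u v [:: w].
  rewrite !upturn_value //; try exact: f_perm.
  rewrite -!fglift_contraction /f -!coeff_normalize; congr coeff.
  have red p q o : redex p q -> perm_eq [:: u; v; w] [:: p, q & o] ->
      reduces a g (contraction a (head_of p q) (next_of p q) (upturn o)).
    move=> pq pqo; have gE : g = graph_of [:: head_of p q, next_of p q & upturn o].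
      by apply: graph_of_perm; apply: perm_trans (upturn_cons p q o); exact: upturn_perm.
    rewrite gE; apply: reduces_intro; last exact: upturn_redex.
    by apply: tractable_linear; rewrite -gE.
  apply: (confluent_normalize (@reduces_decr m n K a) phiP tg (leqnSn _) _ _ conf).
    by apply: red => //; apply/permP => p /=; lia.
  exact: red.
pose nf i := upturn (nth [::] nfs i).
have nf_neq i j : (i < j < 8)%N -> graph_of (nf i) != graph_of (nf j).
  move=> /andP[ij j8]; apply/eqP => /graph_of_erase; apply/negP.
  by have /(pairwiseP [::]) := distinct; apply; rewrite ?inE //; exact: ltn_trans j8.
have nf_eq i j : (i < 8)%N -> (j < 8)%N -> (graph_of (nf i) == graph_of (nf j)) = (i == j).
  move=> i8 j8; case: (ltngtP i j) => [ij|ji|->]; last exact: eqxx.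
    by apply/negbTE/nf_neq; rewrite ij.
  by rewrite eq_sym; apply/negbTE/nf_neq; rewrite ji.
have fE i j : (i < 8)%N -> (j < 8)%N -> f (graph_of (nf j)) (graph_of (nf i)) = (i == j)%:R.
  move=> i8 j8; rewrite /f /normal_coeff (normalize_fix phiP) ?coeff1 ?nf_eq //.
  by apply: supported1; apply/irreducible_graph/(allP irr)/mem_nth.
have key j : (j < 8)%N -> 0 = 
  (a'`_0 ^+ 2 - a'`_0) * (0%N == j)%:R - (a'`_1 ^+ 2 - a'`_1) * (1%N == j)%:R
  + (a'`_2 ^+ 2 - a'`_2) * (2%N == j)%:R - (a'`_3 ^+ 2 - a'`_3) * (3%N == j)%:R
  + a'`_0 * a'`_2 * ((4%N == j)%:R + (5%N == j)%:R)
  - a'`_1 * a'`_3 * ((6%N == j)%:R + (7%N == j)%:R).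
  move=> j8; pose h := graph_of (nf j).
  have ren p d : bijective p -> ((fun d => f h (graph_of d)) \o upturn) (rename_diagram p d) =
      ((fun d => f h (graph_of d)) \o upturn) d.
    by move=> bp /=; rewrite -upturn_rename graph_of_rename //; exact: bij_inj.
  have per d e : perm_eq d e -> ((fun d => f h (graph_of d)) \o upturn) d =
      ((fun d => f h (graph_of d)) \o upturn) e.
    by move=> de /=; apply: f_perm; exact: upturn_perm.
  apply: etrans (etrans (spoly_between per ren fresh (rowE h)) _).
    by apply/esym/eqP; rewrite subr_eq0; apply/eqP; exact: top.
  by rewrite -!fE.
(* Normal forms 0 to 3 isolate the four a_i^2 - a_i, form 4 isolates a_1 a_3 and form 6 isolates a_2
   a_4. *)
have k0 := key 0 isT; have k1 := key 1 isT; have k2 := key 2 isT; have k3 := key 3 isT.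
have k4 := key 4 isT; have k6 := key 6 isT.
rewrite /= ?(mulr1, mulr0, subr0, addr0, add0r, sub0r) in k0 k1 k2 k3 k4 k6.
have sq i : 0 = a'`_i ^+ 2 - a'`_i -> a'`_i = a'`_i ^+ 2.
  by move=> /esym/eqP; rewrite subr_eq0 => /eqP.
split.
  case=> -[|[|[|[|//]]]] i4; rewrite !(tnth_nth 0) /=; apply: sq => //.
    by apply: oppr_inj; rewrite oppr0.
  by apply: oppr_inj; rewrite oppr0.
by split=> //; apply: oppr_inj; rewrite oppr0.
Qed.

End Necessity.

(** * Concrete chains are properadic graphs *)

Section ChainGraphs.
Variables m n : nat.
Implicit Types (d e : diagram m n) (u v : node (wire m n)).

Definition feeds_node u v := has (mem (ins v)) (outs u).

Lemma feeds_node_rename h u v : injective h ->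
  feeds_node (map_node (rename h) u) (map_node (rename h) v) = feeds_node u v.
Proof.
move=> /(@rename_inj m n) hI; rewrite /feeds_node.
have -> : ins (map_node (rename h) v) = map (rename h) (ins v) by case: v.
have -> : outs (map_node (rename h) u) = map (rename h) (outs u) by case: u.
by rewrite has_map; apply: eq_has => x /=; rewrite mem_map.
Qed.

Lemma well_wired_iso d e : graph_of d = graph_of e -> well_wired d -> well_wired e.
Proof.
move=> /graph_ofP/asboolP[h [bh de]] [s [us si so]]; exists (map h s).
have hI := bij_inj bh; have fE (q : forall W, node W -> seq W) :
    (forall u, q _ (map_node (rename h) u) = map (rename h) (q _ u)) ->
    perm_eq (flatten (map (q _) e)) (map (rename h) (flatten (map (q _) d))).
  move=> /flatten_map_rename <-; apply: perm_flatten; apply: perm_map.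
  by rewrite perm_sym.
split; first by rewrite map_inj_uniq.
  apply: perm_trans (fE ins _) _; first by case.
  by rewrite (permPl (perm_map _ si)) map_cat -!map_comp.
apply: perm_trans (fE outs _) _; first by case.
by rewrite (permPl (perm_map _ so)) map_cat -!map_comp.
Qed.

Lemma chain_properadic d u0 : well_wired d -> size d = 3%N ->
  (forall i j, (i < 3)%N -> (j < 3)%N ->
     feeds_node (nth u0 d i) (nth u0 d j) = (j == i.+1)) ->
  properadic_graph 3 (graph_of d).
Proof.
move=> wd sd chain; set e := repr (graph_of d).
have de : graph_of d = graph_of e by rewrite /e /graph_of reprK.
have we := well_wired_iso de wd.
have /graph_ofP/asboolP[h [bh pe]] := de; have hI := bij_inj bh.
set d' := map _ d in pe.
have sd' : size d' = 3%N by rewrite size_map.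
have se : size e = 3%N by rewrite -(perm_size pe).
have ue : uniq e by exact/linear_uniq/well_wired_linear.
(* Being properadic concerns the chosen representative [e], whose order is unknown; [c] gives the
   position of each of its vertices along the chain. *)
pose c (i : 'I_(size e)) := index (tnth (in_tuple e) i) d'.
have c_mem i : tnth (in_tuple e) i \in d' by rewrite (perm_mem pe) mem_tnth.
have c_lt i : (c i < 3)%N by rewrite -sd' index_mem.
have c_inj i j : c i = c j -> i = j.
  move=> cij; have : tnth (in_tuple e) i = tnth (in_tuple e) j.
    by rewrite -(nth_index u0 (c_mem i)) -/(c i) cij nth_index.
  rewrite !(tnth_nth u0) /= => /eqP; rewrite nth_uniq // => /eqP.
  exact: val_inj.
have [i1 ci1] : exists i, c i = 1%N.
  have : nth u0 d' 1 \in e by rewrite -(perm_mem pe) mem_nth // sd'.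
  move=> /(nthP u0)[i ie ei]; exists (Ordinal ie).
  by rewrite /c (tnth_nth u0) /= ei index_uniq ?sd' // (perm_uniq pe).
have feedsE i j : feeds i j = (c j == (c i).+1).
  rewrite -[LHS]/(feeds_node (tnth (in_tuple e) i) (tnth (in_tuple e) j)).
  rewrite -(nth_index u0 (c_mem i)) -(nth_index u0 (c_mem j)) -/(c i) -/(c j).
  by rewrite /d' !(nth_map u0) ?sd // feeds_node_rename // chain.
split=> //.
- move=> i j; rewrite feedsE => /eqP cij; apply/negP => /connectP[p].
  have : (c i < c j)%N by rewrite cij.
  elim: p j {cij} => [|k p IHp] j cij /=; first by move=> _ ij; rewrite ij ltnn in cij.
  move=> /andP[]; rewrite feedsE => /eqP cjk; apply: IHp.
  by rewrite cjk; apply: ltn_trans cij _.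
have sym : connect_sym (fun i j => feeds (d := e) i j || feeds j i).
  by apply: sym_connect_sym => i j; rewrite orbC.
have to1 i : connect (fun i j => feeds (d := e) i j || feeds j i) i i1.
  have [->|] := eqVneq i i1; first exact: connect0.
  move=> ni; apply: connect1; rewrite !feedsE ci1.
  have : c i != 1%N by apply: contraNneq ni => ci; apply/eqP/c_inj; rewrite ci.
  by case: (c i) (c_lt i) => [|[|[|]]].
by move=> i j; apply: connect_trans (to1 i) _; rewrite sym.
Qed.

End ChainGraphs.

(** * The two explicit chains and the conclusion *)

Section Concrete.
Variables (K : fieldType) (a : 4.-tuple K).

Lemma confluent_at m n (g : graph m n) : induces_confluent a -> properadic_graph 3 g ->
  forall c c', clos_refl_trans _ (@step K a m n) << g >> c ->
     clos_refl_trans _ (@step K a m n) << g >> c' ->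
     exists q, clos_refl_trans _ (@step K a m n) c q /\
               clos_refl_trans _ (@step K a m n) c' q.
Proof.
move=> conf gP c c'; apply: conf => h.
by rewrite coeff1; case: (eqVneq g h) => [<-|_]; rewrite ?eqxx.
Qed.

Lemma product_chain : properadic_graph 3 (graph_of
  [:: Mu (In ord0) (In (lift ord0 ord0)) (Int 0); Mu (Int 0) (In ord_max) (Int 1);
      Delta (Int 1) (Out ord0) (Out ord_max)] : graph 2 3).
Proof.
apply: (@chain_properadic 2 3 _ (Mu (Int 0) (Int 0) (Int 0))) => //.
  by exists [:: 0%N; 1%N]; rewrite !enum_ordSl !enum_ord0.
by case=> [|[|[|//]]] [|[|[|//]]].
Qed.

Lemma confluent_in_C : induces_confluent a -> in_C a.
Proof.
move=> conf.
apply: (@confluent_in_C_upturn 2 3 K a false (In ord0) (In (lift ord0 ord0)) (In ord_max)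
  (Out ord0) (Out ord_max)); rewrite /upturn.
- by vm_compute.
- by vm_compute.
- by vm_compute.
- by vm_compute.
- exact/properadic_tractable/product_chain.
- exact/confluent_at/product_chain.
Qed.

Lemma coproduct_chain : properadic_graph 3 (graph_of
  [:: Mu (In ord0) (In ord_max) (Int 1); Delta (Int 1) (Int 0) (Out ord_max);
      Delta (Int 0) (Out ord0) (Out (lift ord0 ord0))] : graph 3 2).
Proof.
apply: (@chain_properadic 3 2 _ (Mu (Int 0) (Int 0) (Int 0))) => //.
  by exists [:: 0%N; 1%N]; rewrite !enum_ordSl !enum_ord0.
by case=> [|[|[|//]]] [|[|[|//]]].
Qed.

Lemma confluent_in_C_tilde : induces_confluent a -> in_C (tilde a).
Proof.
move=> conf.
(* [flip] keeps the names of wires, so the factors are named by output legs and the results by input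
   legs before turning. *)
have gP : properadic_graph 3 (graph_of (upturn true
    [:: Mu (Out ord0) (Out (lift ord0 ord0)) (Int 0); Mu (Int 0) (Out ord_max) (Int 1);
      Delta (Int 1) (In ord0) (In ord_max)]) : graph 3 2).
  rewrite (graph_of_perm (e := [:: Mu (In ord0) (In ord_max) (Int 1);
      Delta (Int 1) (Int 0) (Out ord_max);
      Delta (Int 0) (Out ord0) (Out (lift ord0 ord0))])); first exact: coproduct_chain.
  by apply/permP => b /=; lia.
apply: (@confluent_in_C_upturn 3 2 K a true (Out ord0) (Out (lift ord0 ord0)) (Out ord_max)
  (In ord0) (In ord_max)).
- by vm_compute.
- by vm_compute.
- by vm_compute.
- by vm_compute.
- exact/properadic_tractable.
- exact/confluent_at.
Qed.

End Concrete.

Theorem proposition4p7 (R : realType) (a : 4.-tuple R[i]) :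
  (induces_confluent a <-> in_C a /\ in_C (tilde a)) /\
  (induces_confluent a <->
    (forall i : 'I_4, tnth a i = tnth a i ^+ 2) /\
    [/\ a`_0 * a`_2 = 0, a`_0 * a`_3 = 0, a`_1 * a`_2 = 0 & a`_1 * a`_3 = 0]).
Proof.
have confE : induces_confluent a <-> in_C a /\ in_C (tilde a).
  split=> [conf|[aC aC']]; last exact: in_C_confluent.
  by split; [exact: confluent_in_C|exact: confluent_in_C_tilde].
split=> //; rewrite confE; split=> [[[aa [a13 a02]] [_ [a03 a12]]]|[aa [a02 a03 a12 a13]]].
  by split.
split; first by split.
split; last by split.
case=> -[|[|[|[|//]]]] i4; rewrite (tnth_nth 0) /=.
- by have := aa (Ordinal (isT : 1 < 4)%N); rewrite (tnth_nth 0).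
- by have := aa (Ordinal (isT : 0 < 4)%N); rewrite (tnth_nth 0).
- by have := aa (Ordinal i4); rewrite (tnth_nth 0).
- by have := aa (Ordinal i4); rewrite (tnth_nth 0).
Qed.
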